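(* Let $h$ satisfy the assumption in the context and $\alpha>0$. For $N\ge2$ let $c_N$ be the unique positive solution of $$\frac{1}{\sqrt{2(N-1)\alpha/N}}\tanh\Big(c_N\sqrt{\tfrac{2(N-1)\alpha}{N}}\Big)=\frac{p_N'(c_N)-1}{p_N''(c_N)},$$ and let $c$ be the unique positive solution of $$\frac1{\sqrt{2\alpha}}\tanh(c\sqrt{2\alpha})=\frac{p_1'(c)-1}{p_1''(c)}.$$ Then $\lim_{N\to\infty}c_N=c$. Moreover, when $h(x)=x^2$, $c_N$ is a decreasing function of $N$.
   Context: **Assumption on $h$.** $h:\mathbb R\to\mathbb R$ is convex, symmetric (even), twice differentiable, $h(0)\ge0$, $h''$ decreasing (in the weak sense, so that $h(x)=x^2$ is allowed) on $\mathbb R^+$, $0<k<h''(x)\le K$ for constants $K>k>0$. With $B$ a standard one-dimensional Brownian motion, $$p_1(x)=\mathbb E\int_0^\infty e^{-\alpha t}h(x+B_t)dt,\qquad p_N(x)=\mathbb E\int_0^\infty e^{-\alpha t}h\Big(\tfrac{N-1}{N}\big(x+\sqrt{\tfrac N{N-1}}\,B_t\big)\Big)dt\quad(N\ge2).$$ *)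

(* Defs.v *)
From HB Require Import structures.
From mathcomp Require Import all_boot all_order all_algebra.
From mathcomp Require Import all_classical all_reals all_analysis.

Set Implicit Arguments.
Unset Strict Implicit.
Unset Printing Implicit Defensive.

Import Order.TTheory GRing.Theory Num.Theory.
Import numFieldNormedType.Exports.

Local Open Scope classical_set_scope.
Local Open Scope ring_scope.

Definition tanh (R : realType) (x : R) : R :=
  (expR x - expR (- x)) / (expR x + expR (- x)).

(* The family is finite and each A i may be setT, so the product rule for the
   whole family contains the rule for every subfamily. *)
Definition mutually_independent (R : realType) (d : measure_display)
    (T : measurableType d) (P : probability T R) (I : finType)
    (X : I -> T -> R) : Prop :=
  forall A : I -> set R, (forall i, measurable (A i)) ->
    (P (\bigcap_(i in [set: I]) (X i @^-1` A i)) =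
     \prod_(i : I) P (X i @^-1` A i))%E.

(* Time is [0, +oo[: the variables B t with t < 0 are unconstrained and unused.
   The increment law is required for s < t only, because normal_prob m 0 is not
   the Dirac mass at m. *)
Record standard_brownian_motion (R : realType) (d : measure_display)
    (T : measurableType d) (P : probability T R) (B : R -> {RV P >-> R}) : Prop := {
  bm_start : {ae P, forall w, B 0 w = 0};
  bm_continuous : forall w, {within `[0, +oo[, continuous (fun t : R => B t w)};
  bm_gaussian : forall s t : R, 0 <= s -> s < t ->
    forall A : set R, measurable A ->
      P [set w | A (B t w - B s w)] = normal_prob 0 (Num.sqrt (t - s)) A;
  bm_independent : forall (n : nat) (t : nat -> R),
    0 <= t 0%N -> (forall i, (i < n)%N -> t i < t i.+1) ->
    mutually_independent P (fun (i : 'I_n) w => B (t i.+1) w - B (t i) w)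
}.

Record admissible_cost (R : realType) (h : R -> R) : Prop := {
  cost_convex : convex_function [set: convex_lmodType R^o] h;
  cost_even : forall x, h (- x) = h x;
  cost_derivable : forall x, derivable h x 1;
  cost_derivable2 : forall x, derivable (derive1 h) x 1;
  cost_ge0 : 0 <= h 0;
  cost_curvature_noninc :
    forall x y, 0 <= x -> x <= y -> derive1n 2 h y <= derive1n 2 h x;
  cost_curvature_bounds : exists k K : R,
    [/\ 0 < k, k < K & forall x, k < derive1n 2 h x /\ derive1n 2 h x <= K]
}.

Section value_functions.
Context {R : realType} {d : measure_display} {T : measurableType d}.
Variables (P : probability T R) (B : R -> T -> R) (alpha : R).

Definition discounted_mean (g : R -> R) : R :=
  fine (\int[P]_w \int[lebesgue_measure]_(t in `[0%R, +oo[)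
          (expR (- (alpha * t)) * g (B t w))%R%:E)%E.

Definition p_one (h : R -> R) (x : R) : R :=
  discounted_mean (fun b => h (x + b)).

Definition p_many (h : R -> R) (N : nat) (x : R) : R :=
  discounted_mean (fun b =>
    h ((N%:R - 1) / N%:R * (x + Num.sqrt (N%:R / (N%:R - 1)) * b))).

End value_functions.

Definition positive_solution (R : realType) (lambda : R) (p : R -> R) (c : R)
    : Prop :=
  0 < c /\
  1 / Num.sqrt lambda * tanh (c * Num.sqrt lambda) =
    (derive1 p c - 1) / derive1n 2 p c.

Definition threshold_one (R : realType) (d : measure_display)
    (T : measurableType d) (P : probability T R) (B : R -> T -> R)
    (h : R -> R) (alpha : R) (c : R) : Prop :=
  positive_solution (2 * alpha) (p_one P B alpha h) c.

Definition threshold_many (R : realType) (d : measure_display)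
    (T : measurableType d) (P : probability T R) (B : R -> T -> R)
    (h : R -> R) (alpha : R) (N : nat) (c : R) : Prop :=
  positive_solution (2 * (N%:R - 1) * alpha / N%:R) (p_many P B alpha h N) c.

(* Main.v *)
(** Write [F(x) = p'(x) - 1 - p''(x) T(x)] with [T(x) = tanh(r x) / r] and
    [r = sqrt lambda], so that thresholds are the positive zeros of [F]. Here
    [p'(0) = 0] by symmetry, [p''] is bounded below, and [p''] is nonincreasing
    on the half-line: [h''] is even and radially nonincreasing and centred
    Gaussian laws are symmetric unimodal. Since [0 <= T' <= 1], [F] is then
    strictly increasing, negative near [0] and positive far away, which gives
    existence and uniqueness. As [N] grows, [p_N'] converges pointwise ([h'] is
    Lipschitz), hence so does [p_N''] by concavity of [p_N'], and the zero of
    [F_N] converges to that of [F]. For [h(x) = x^2] the equation reads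
    [c - T(c) = alpha / (2 a^2)] with [a = (N - 1) / N]; the left side increases
    with [c] and with [lambda = 2 alpha a], and the right side decreases with
    [a].

    All expectations are taken with respect to Brownian motion stopped at an
    independent exponential time, whose second moment is finite, so that
    Tonelli and differentiation under the integral sign apply. *)

Require Import Defs.
From HB Require Import structures.
From mathcomp Require Import all_boot all_order all_algebra.
From mathcomp Require Import all_classical all_reals all_analysis.
From mathcomp Require Import lebesgue_integral_under measurable_realfun ring lra.

Import Order.TTheory GRing.Theory Num.Theory.
Import numFieldNormedType.Exports.

Local Open Scope classical_set_scope.
Local Open Scope ring_scope.

(** * Hyperbolic tangent *)

Section real_lemmas.
Context {R : realType}.
Implicit Types (f df : R -> R) (a b x y r : R).

Lemma is_derive_MVT f df a b : a < b ->
  (forall x, a <= x <= b -> is_derive x 1 f (df x)) ->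
  exists2 c, a < c < b & f b - f a = df c * (b - a).
Proof.
move=> ab dfE.
have cf : {within `[a, b], continuous f}.
  apply: derivable_within_continuous => x; rewrite in_itv/= => /dfE.
  by case.
have dfoo x : x \in `]a, b[%R -> is_derive x 1 f (df x).
  by rewrite in_itv/= => /andP[ax xb]; apply: dfE; rewrite !ltW.
by have [c] := MVT ab dfoo cf; rewrite in_itv/=; exists c.
Qed.

Lemma is_derive_mulr r x : is_derive x 1 (fun y : R => y * r) r.
Proof.
have -> : (fun y : R => y * r) = r \*: (id : R -> R).
  by apply/funext => y; rewrite /= [RHS]/GRing.scale/= mulrC.
by apply: is_derive_eq; rewrite /GRing.scale/= mulr1.
Qed.

Lemma tanh_den_gt0 x : 0 < expR x + expR (- x).
Proof. by rewrite addr_gt0 ?expR_gt0. Qed.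

Lemma tanh0 : tanh (0 : R) = 0.
Proof. by rewrite /tanh oppr0 subrr mul0r. Qed.

Lemma is_derive_sinh2 x :
  is_derive x 1 (fun y => expR y - expR (- y)) (expR x + expR (- x)).
Proof.
have d2 : is_derive x 1 (fun y : R => expR (- y)) (- expR (- x)).
  have := @is_derive1_comp R expR -%R x (expR (- x)) (-1) _ _.
  by rewrite mulrN1; exact.
by rewrite -[X in _ + X]opprK; exact: is_deriveB.
Qed.

Lemma is_derive_cosh2 x :
  is_derive x 1 (fun y => expR y + expR (- y)) (expR x - expR (- x)).
Proof.
have d2 : is_derive x 1 (fun y : R => expR (- y)) (- expR (- x)).
  have := @is_derive1_comp R expR -%R x (expR (- x)) (-1) _ _.
  by rewrite mulrN1; exact.
exact: is_deriveD.
Qed.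

Lemma is_derive_tanh x : is_derive x 1 (@tanh R) (1 - tanh x ^+ 2).
Proof.
have c0 : expR x + expR (- x) != 0 by rewrite gt_eqF// tanh_den_gt0.
have dS := is_derive_sinh2 x; have dC := is_derive_cosh2 x.
have dV := @is_deriveV R _ x _ 1 c0 dC.
rewrite [X in is_derive _ _ X _](_ : _ = (fun y => expR y - expR (- y)) *
   (fun y => (expR y + expR (- y))^-1))//.
apply: is_derive_eq.
rewrite /tanh /GRing.scale/=; field.
exact: c0.
Qed.

Lemma tanh_lt1 x : tanh x < 1.
Proof.
rewrite /tanh ltr_pdivrMr ?tanh_den_gt0// mul1r.
by have := expR_gt0 (- x); lra.
Qed.

Lemma tanh_gt0 x : 0 < x -> 0 < tanh x.
Proof.
move=> x0; rewrite /tanh divr_gt0 ?tanh_den_gt0// subr_gt0 ltr_expR; lra.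
Qed.

Lemma tanh_ge0 x : 0 <= x -> 0 <= tanh x.
Proof. by rewrite le0r => /predU1P[->|/tanh_gt0/ltW//]; rewrite tanh0. Qed.

Lemma tanh_ltr x y : 0 <= x -> x < y -> tanh x < tanh y.
Proof.
move=> x0 xy; have [c /andP[xc cy] e] := @is_derive_MVT _ (fun x => 1 - tanh x ^+ 2) _ _ xy
  (fun z _ => is_derive_tanh z).
rewrite -subr_gt0 e mulr_gt0 ?subr_gt0// expr_lt1 ?tanh_lt1//.
by apply: tanh_ge0; lra.
Qed.

(** The derivative [1 - tanh^2] decreases on the half-line, so the mean slope of [tanh] over
    [[0, x]] is at least the one over [[x, y]]. Equivalently, [tanh z / z] is nonincreasing. *)
Lemma tanh_star x y : 0 < x -> x < y -> tanh y * x <= tanh x * y.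
Proof.
move=> x0 xy.
have [c /andP[c0 cx]] := @is_derive_MVT _ (fun x => 1 - tanh x ^+ 2) _ _ x0
  (fun z _ => is_derive_tanh z).
rewrite tanh0 !subr0 => ex.
have [e /andP[xe ey] exy] := @is_derive_MVT _ (fun x => 1 - tanh x ^+ 2) _ _ xy
  (fun z _ => is_derive_tanh z).
have tce : tanh c ^+ 2 <= tanh e ^+ 2.
  have h := tanh_ltr c e (ltW c0) (lt_trans cx xe).
  rewrite ler_pXn2r//; first exact: ltW.
    by rewrite nnegrE tanh_ge0//; lra.
  by rewrite nnegrE tanh_ge0//; lra.
have ->: tanh y = tanh x + (1 - tanh e ^+ 2) * (y - x) by rewrite -exy; ring.
rewrite ex.
have : 0 <= (tanh e ^+ 2 - tanh c ^+ 2) * ((y - x) * x).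
  by apply: mulr_ge0; [lra|apply: mulr_ge0; lra].
by nra.
Qed.

Definition tanh_scaled r x : R := 1 / r * tanh (x * r).

Lemma is_derive_tanh_scaled r x : 0 < r ->
  is_derive x 1 (tanh_scaled r) (1 - tanh (x * r) ^+ 2).
Proof.
move=> r0; rewrite /tanh_scaled.
have d1 := is_derive_mulr r x.
have d2 := @is_derive1_comp R _ _ x _ _ (is_derive_tanh (x * r)) d1.
rewrite [X in is_derive _ _ X _](_ : _ =
  (1 / r) \*: (@tanh R \o (fun y : R => y * r)))//.
apply: is_derive_eq; rewrite /GRing.scale/=; field.
by rewrite gt_eqF.
Qed.

Lemma tanh_scaled_contract r x y : 0 < r -> 0 <= x -> x < y ->
  tanh_scaled r y - tanh_scaled r x < y - x.
Proof.
move=> r0 x0 xy.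
have [c /andP[xc _] ->] := is_derive_MVT _ _ _ _ xy (fun z _ => is_derive_tanh_scaled r z r0).
have c0 : 0 < c * r by rewrite mulr_gt0//; lra.
rewrite gtr_pMl ?subr_gt0// ltrBlDr ltrDl exprn_gt0//; exact: tanh_gt0.
Qed.

Lemma tanh_scaled0 r : tanh_scaled r 0 = 0.
Proof. by rewrite /tanh_scaled mul0r tanh0 mulr0. Qed.

Lemma tanh_scaled_ge0 r x : 0 < r -> 0 <= x -> 0 <= tanh_scaled r x.
Proof.
move=> r0 x0; apply: mulr_ge0; first by rewrite divr_ge0// ltW.
by apply: tanh_ge0; rewrite mulr_ge0// ltW.
Qed.

Lemma tanh_scaled_ub r x : 0 < r -> tanh_scaled r x < r^-1.
Proof.
by move=> r0; rewrite /tanh_scaled mul1r gtr_pMr ?invr_gt0// tanh_lt1.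
Qed.

(** Writing [tanh_scaled r x] as [x] times [tanh z / z] at [z = x * r] reduces this to the
    monotonicity of that quotient. *)
Lemma tanh_scaled_noninc r s x : 0 < r -> r <= s -> 0 < x ->
  tanh_scaled s x <= tanh_scaled r x.
Proof.
move=> r0; rewrite le_eqVlt => /predU1P[->//|rs] x0.
have s0 := lt_trans r0 rs.
rewrite /tanh_scaled !mul1r ler_pdivrMl// mulrCA ler_pdivlMl//.
have := tanh_star (x * r) (x * s) (mulr_gt0 x0 r0).
rewrite ltr_pM2l// => /(_ rs).
rewrite [leLHS]mulrCA [leRHS]mulrCA ler_pM2l//.
by rewrite mulrC [leRHS]mulrC.
Qed.

Lemma cvg_tanh_scaled (r_ : nat -> R) r x : 0 < r -> r_ @ \oo --> r ->
  tanh_scaled (r_ n) x @[n --> \oo] --> tanh_scaled r x.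
Proof.
move=> r0 rr; apply: cvgM.
  by apply: cvgM; [exact: cvg_cst|apply: cvgV; rewrite ?gt_eqF].
refine (@cvg_comp _ _ _ (fun n => x * r_ n) (@tanh R) _ (nbhs (x * r)) _ _ _).
  by apply: cvgM => //; exact: cvg_cst.
by apply/differentiable_continuous/derivable1_diffP; have [] := is_derive_tanh (x * r).
Qed.

End real_lemmas.

(** * The free-boundary equation *)

Section threshold.
Context {R : realType}.
Implicit Types x y z c : R.
Variables (f g : R -> R) (m r : R).
Hypothesis f0 : f 0 = 0.
Hypothesis dfg : forall x : R, is_derive x 1 f (g x).
Hypothesis g_noninc : forall x y : R, 0 <= x -> x <= y -> g y <= g x.
Hypotheses (m0 : 0 < m) (g_lb : forall x, m <= g x).
Hypothesis r0 : 0 < r.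

(** This is the [F] of the overview, with [f] in the role of [p'] and [g] in the role of [p'']. *)
Definition free_boundary x := f x - 1 - g x * tanh_scaled r x.

Local Notation F := free_boundary.

Lemma free_boundary_eq c :
  1 / r * tanh (c * r) = (f c - 1) / g c <-> F c = 0.
Proof.
have gc0 : g c != 0 by rewrite gt_eqF// (lt_le_trans m0).
rewrite /F /tanh_scaled; split => [->|/subr0_eq e].
  by rewrite mulrC divfK// subrr.
by rewrite e [RHS]mulrAC divff// !mul1r.
Qed.

(** With [T] for [tanh_scaled r] and [c] the mean value point of [f], the increment of [F] is [(g c
    - g y) (y - x) + g y ((y - x) - (T y - T x)) + (g x - g y) T x]. The outer terms are nonnegative
    because [g] is nonincreasing, and the middle one is positive because [T] contracts strictly. *)
Lemma free_boundary_ltr x y : 0 <= x -> x < y -> F x < F y.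
Proof.
move=> x0 xy; rewrite /F.
have [c /andP[xc cy] e] := is_derive_MVT _ _ _ _ xy (fun z _ => dfg z).
have gy0 : 0 < g y by rewrite (lt_le_trans m0).
have gcy : g y <= g c by apply: g_noninc => //; lra.
have gxy : g y <= g x by apply: g_noninc => //; lra.
have Tx := tanh_scaled_ge0 r x r0 x0.
have := tanh_scaled_contract r x y r0 x0 xy.
rewrite -(ltr_pM2l gy0) => h.
have h2 : 0 <= (g x - g y) * tanh_scaled r x by rewrite mulr_ge0// subr_ge0.
have h3 : 0 <= (g c - g y) * (y - x) by rewrite mulr_ge0// subr_ge0// ltW.
by nra.
Qed.

Lemma free_boundary_lt0 x : 0 <= x -> x * g 0 < 1 -> F x < 0.
Proof.
rewrite le0r => /predU1P[-> _|x0 xg]; first by rewrite /F f0 tanh_scaled0; lra.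
have [c /andP[c0 cx]] := is_derive_MVT _ _ _ _ x0 (fun z _ => dfg z).
rewrite f0 !subr0 /F => ->.
have h : g c <= g 0 by apply: g_noninc => //; exact: ltW.
have h1 : g c * x <= x * g 0 by rewrite mulrC ler_pM2l.
have : 0 <= g x * tanh_scaled r x.
  by rewrite mulr_ge0 ?tanh_scaled_ge0 ?ltW// (lt_le_trans m0).
lra.
Qed.

(** The mean value theorem gives [f x >= g x * x], hence [F x >= g x (x - T x) - 1]. The term [r^-1]
    of the bound absorbs [T x], and [m^-1] makes the product exceed 1. *)
Lemma free_boundary_gt0 x : r^-1 + m^-1 <= x -> 0 < F x.
Proof.
move=> h; have ri : 0 < r^-1 by rewrite invr_gt0.
have mi : 0 < m^-1 by rewrite invr_gt0.
have x0 : 0 < x by lra.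
have [c /andP[c0 cx]] := is_derive_MVT _ _ _ _ x0 (fun z _ => dfg z).
rewrite f0 !subr0 /F => ->.
have gxc : g x <= g c by apply: g_noninc; exact: ltW.
have T := tanh_scaled_ub r x r0.
have h1 : m^-1 < x - tanh_scaled r x by lra.
have gx0 : 0 < g x by rewrite (lt_le_trans m0).
have h2 : g x * m^-1 < g x * (x - tanh_scaled r x) by rewrite ltr_pM2l.
have h3 : 1 <= g x * m^-1 by rewrite ler_pdivlMr// mul1r.
have h4 : g x * x <= g c * x by rewrite ler_pM2r.
lra.
Qed.

(* A derivative is only known to be a Darboux function, so the zero of F is
   found as an interior maximum of (f - 1) / sinh (r x), whose derivative is a
   negative multiple of F. *)
Lemma free_boundary_zero : exists2 c, 0 < c & F c = 0.
Proof.
(* [S] and [C] are [2 sinh (r x)] and [2 cosh (r x)]. *)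
pose S x := expR (x * r) - expR (- (x * r)).
pose C x := expR (x * r) + expR (- (x * r)).
have S0 x : 0 < x -> 0 < S x.
  by move=> x0; rewrite /S subr_gt0 ltr_expR; have := mulr_gt0 x0 r0; lra.
have C0 x : 0 < C x by exact: tanh_den_gt0.
pose G x := (f x - 1) * (S x)^-1.
have dG x : 0 < x -> is_derive x 1 G (- (r * C x / S x ^+ 2) * F x).
  move=> x0.
  have Sx0 : S x != 0 by rewrite gt_eqF// S0.
  have d1 := is_derive_mulr r x.
  have dS : is_derive x 1 S (C x * r).
    exact: (@is_derive1_comp R _ _ x _ _ (is_derive_sinh2 (x * r)) d1).
  have dV := @is_deriveV R _ x _ 1 Sx0 dS.
  have df1 : is_derive x 1 (fun x => f x - 1) (g x).
    by rewrite -[g x]subr0; exact: is_deriveB.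
  rewrite [X in is_derive _ _ X _](_ : _ = (fun x => f x - 1) * (fun x => (S x)^-1))//.
  apply: is_derive_eq; rewrite /F /tanh_scaled /tanh -/(S x) -/(C x) /GRing.scale/=.
  field.
  by rewrite Sx0 ?gt_eqF ?C0.
have K0 x : 0 < x -> 0 < r * C x / S x ^+ 2.
  by move=> x0; rewrite divr_gt0 ?exprn_gt0 ?mulr_gt0 ?S0.
have g00 : 0 < g 0 by rewrite (lt_le_trans m0).
(* Since [e' * g 0 = 1 / 2], [F] is negative on [[e, e']]; the left end [e] stays positive because
   [S] vanishes at 0. *)
pose e' := (g 0)^-1 / 2; pose e := e' / 2.
have ri : 0 < r^-1 by rewrite invr_gt0.
have mi : 0 < m^-1 by rewrite invr_gt0.
have gi : 0 < (g 0)^-1 by rewrite invr_gt0.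
have e0 : 0 < e by rewrite /e /e'; lra.
have ee' : e < e' by rewrite /e /e'; lra.
have Fe' : F e' < 0.
  apply: free_boundary_lt0; first by lra.
  by rewrite /e' mulrAC mulVf ?gt_eqF//; lra.
have e'0 : 0 < e' by lra.
pose M := r^-1 + m^-1 + e'.
have FM : 0 < F M by apply: free_boundary_gt0; rewrite /M; lra.
have e'M : e' < M by rewrite /M; lra.
have dGM x : e <= x <= M + 1 -> is_derive x 1 G (- (r * C x / S x ^+ 2) * F x).
  by move=> /andP[ex xM]; apply: dG; lra.
have [] := @EVT_max _ G e (M + 1); first by lra.
  apply: derivable_within_continuous => x; rewrite in_itv/= => /dGM.
  by case.
move=> c; rewrite in_itv/= => /andP[ec cM] maxc.
have c0 : 0 < c by lra.
exists c => //.
(* [F < 0] just to the right of [e], so [G] increases there and its maximum is not at [e].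
   Symmetrically, [F > 0] on [[M, M + 1]], so [G] decreases there and the right end is excluded as
   well. *)
have ce : e != c.
  apply/eqP => ce.
  have [z /andP[ez ze'] Ge] := is_derive_MVT _ _ _ _ ee' (fun z h =>
    dGM z ltac:(by move: h => /andP[? ?]; apply/andP; split; lra)).
  have Fz : F z < 0 by rewrite (lt_trans _ Fe')// free_boundary_ltr//; lra.
  have : G e' <= G e by rewrite ce; apply: maxc; rewrite in_itv/= !ltW//; lra.
  rewrite -subr_le0 Ge leNgt => /negP; apply.
  have z0 : 0 < z by lra.
  rewrite mulr_gt0 ?subr_gt0// mulNr -mulrN mulr_gt0 ?oppr_gt0//.
  exact: K0.
have cM1 : c != M + 1.
  apply/eqP => cM1.
  have MM1 : M < M + 1 by lra.
  have [z /andP[ez ze'] Ge] := is_derive_MVT _ _ _ _ MM1 (fun z h =>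
    dGM z ltac:(by move: h => /andP[? ?]; apply/andP; split; lra)).
  have Fz : 0 < F z by rewrite (lt_trans FM)// free_boundary_ltr//; lra.
  have : G M <= G (M + 1) by rewrite -cM1; apply: maxc; rewrite in_itv/=; apply/andP; split; lra.
  rewrite -subr_ge0 Ge leNgt => /negP; apply.
  have z0 : 0 < z by lra.
  rewrite nmulr_rlt0 ?subr_gt0// mulNr oppr_lt0 mulr_gt0//.
  exact: K0.
have eM : e <= M + 1 by lra.
have := @derive1_at_max R G e (M + 1) c eM.
case.
- move=> t; rewrite in_itv/= => /andP[et _].
  by have [] := dG t (lt_trans e0 et).
- by rewrite in_itv/= !lt_neqAle ce ec cM1 cM.
- by move=> t; rewrite in_itv/= => /andP[? ?]; apply: maxc; rewrite in_itv/= !ltW.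
move=> _; have [_ ->] := dG c c0.
move=> /eqP; rewrite mulf_eq0 oppr_eq0 gt_eqF ?K0//= => /eqP.
by [].
Qed.

Lemma threshold_exists_unique : exists! c,
  0 < c /\ 1 / r * tanh (c * r) = (f c - 1) / g c.
Proof.
have [c c0 Fc] := free_boundary_zero.
exists c; split; first by split => //; apply/free_boundary_eq.
move=> c' [c'0 /free_boundary_eq Fc'].
have [h|h|//] := ltgtP c c'.
  by have := free_boundary_ltr _ _ (ltW c0) h; rewrite Fc Fc' ltxx.
by have := free_boundary_ltr _ _ (ltW c'0) h; rewrite Fc Fc' ltxx.
Qed.

End threshold.

(** * Stability of the threshold under pointwise convergence *)

Section threshold_cvg.
Context {R : realType}.
Implicit Types x y z c : R.
Variables (f g : R -> R) (m r : R) (f_ g_ : nat -> R -> R) (m_ r_ : nat -> R).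
Hypothesis f0 : f 0 = 0.
Hypothesis dfg : forall x : R, is_derive x 1 f (g x).
Hypothesis g_noninc : forall x y : R, 0 <= x -> x <= y -> g y <= g x.
Hypotheses (m0 : 0 < m) (g_lb : forall x, m <= g x).
Hypothesis r0 : 0 < r.
Hypothesis dfg_ : forall n (x : R), is_derive x 1 (f_ n) (g_ n x).
Hypothesis g_noninc_ : forall n (x y : R), 0 <= x -> x <= y -> g_ n y <= g_ n x.
Hypotheses (m0_ : forall n, 0 < m_ n) (g_lb_ : forall n x, m_ n <= g_ n x).
Hypothesis r0_ : forall n, 0 < r_ n.
Hypothesis cvg_f : forall x, f_ n x @[n --> \oo] --> f x.
Hypothesis cvg_r : r_ @ \oo --> r.

(* For concave functions, pointwise convergence implies convergence of the
   derivatives, which are squeezed between difference quotients. *)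
Lemma cvg_concave_derivative x : 0 < x -> g_ n x @[n --> \oo] --> g x.
Proof.
move=> x0; apply/cvgrPdist_lt => e e0.
have [dx <-] := dfg x; move: dx => /cvg_ex[l dl].
have -> : 'D_1 f x = l by exact/cvg_lim.
move/cvgrPdist_lt : dl => /(_ (e / 2)) []; first by lra.
move=> d /= d0 dl.
(* [h < d] brings both difference quotients of [f] within [e / 2] of the derivative; [h < x] keeps
   [x - h] in the region where [g_ n] is nonincreasing. *)
pose h := Num.min (d / 2) (x / 2).
have h0 : 0 < h by rewrite lt_min; apply/andP; split; lra.
have hd : h < d by rewrite gt_min; apply/orP; left; lra.
have hx : h < x by rewrite gt_min; apply/orP; right; lra.
have hN0 : h != 0 by rewrite gt_eqF.
have up : `|l - h^-1 * (f (x + h) - f x)| < e / 2.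
  have := dl h; rewrite /GRing.scale/= mulr1 [h + x]addrC; apply => //.
  by rewrite /= sub0r normrN gtr0_norm.
have dn : `|l - h^-1 * (f x - f (x - h))| < e / 2.
  have := dl (- h); rewrite /GRing.scale/= mulr1 [- h + x]addrC invrN mulNr -mulrN opprB.
  apply; last by rewrite oppr_eq0.
  by rewrite /= sub0r normrN normrN gtr0_norm.
have cu : h^-1 * (f_ n (x + h) - f_ n x) @[n --> \oo] --> h^-1 * (f (x + h) - f x).
  by apply: cvgM; [exact: cvg_cst|exact: cvgB].
have cd : h^-1 * (f_ n x - f_ n (x - h)) @[n --> \oo] --> h^-1 * (f x - f (x - h)).
  by apply: cvgM; [exact: cvg_cst|exact: cvgB].
have e20 : 0 < e / 2 by lra.
move/cvgrPdist_lt : cu => /(_ _ e20) cu.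
move/cvgrPdist_lt : cd => /(_ _ e20) cd.
near=> n.
have cu' : `|h^-1 * (f (x + h) - f x) - h^-1 * (f_ n (x + h) - f_ n x)| < e / 2.
  by near: n; exact: cu.
have cd' : `|h^-1 * (f x - f (x - h)) - h^-1 * (f_ n x - f_ n (x - h))| < e / 2.
  by near: n; exact: cd.
have xh : x < x + h by lra.
have [z /andP[xz zh] ez] := is_derive_MVT _ _ _ _ xh (fun z _ => dfg_ n z).
have hx' : x - h < x by lra.
have [y /andP[hy yx] ey] := is_derive_MVT _ _ _ _ hx' (fun z _ => dfg_ n z).
move: cu' cd'; rewrite ez ey (_ : x + h - x = h); last by ring.
rewrite (_ : x - (x - h) = h); last by ring.
rewrite ![h^-1 * (_ * h)]mulrC !mulfK//.
have yg : g_ n x <= g_ n y by apply: g_noninc_; lra.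
have zg : g_ n z <= g_ n x by apply: g_noninc_; lra.
move: up dn; rewrite !ltr_norml => /andP[u1 u2] /andP[v1 v2] /andP[w1 w2] /andP[t1 t2].
apply/andP; split; lra.
Unshelve. all: by end_near. Qed.

(** For small [h], the limit function satisfies [F (c - h) < 0 < F (c + h)]. Pointwise convergence
    carries both signs over to the approximating functions for large [n], and these are strictly
    increasing, so their zeros [c_ n] lie between [c - h] and [c + h]. *)
Lemma threshold_cvg (c_ : nat -> R) c :
  (\forall n \near \oo, 0 < c_ n /\
     1 / r_ n * tanh (c_ n * r_ n) = (f_ n (c_ n) - 1) / g_ n (c_ n)) ->
  0 < c -> 1 / r * tanh (c * r) = (f c - 1) / g c ->
  c_ @ \oo --> c.
Proof.
move=> c_E c0 /(free_boundary_eq f g m r m0 g_lb) Fc.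
have cvgF x : 0 < x -> free_boundary (f_ n) (g_ n) (r_ n) x @[n --> \oo] -->
    free_boundary f g r x.
  move=> x0; apply: cvgB.
    by apply: cvgB; [exact: cvg_f|exact: cvg_cst].
  by apply: cvgM; [exact: cvg_concave_derivative|exact: cvg_tanh_scaled].
apply/cvgrPdist_lt => e e0.
pose h := Num.min (e / 2) (c / 2).
have h0 : 0 < h by rewrite lt_min; apply/andP; split; lra.
have he : h < e by rewrite gt_min; apply/orP; left; lra.
have hc : h < c by rewrite gt_min; apply/orP; right; lra.
have Flt := free_boundary_ltr f g m r dfg g_noninc m0 g_lb r0.
have cph : 0 < c + h by lra.
have cmh : 0 < c - h by lra.
have Fu : 0 < free_boundary f g r (c + h) by rewrite -Fc; apply: Flt; lra.
have Fd : free_boundary f g r (c - h) < 0 by rewrite -Fc; apply: Flt; lra.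
have nu := @cvgr_gt R _ _ _ _ _ (cvgF (c + h) cph) _ Fu.
have nd := @cvgr_lt R _ _ _ _ _ (cvgF (c - h) cmh) _ Fd.
near=> n.
have [cn0 cnE] : 0 < c_ n /\
     1 / r_ n * tanh (c_ n * r_ n) = (f_ n (c_ n) - 1) / g_ n (c_ n) by near: n; exact: c_E.
have /free_boundary_eq -/(_ (m_ n) (m0_ n) (g_lb_ n)) Fn := cnE.
have un : 0 < free_boundary (f_ n) (g_ n) (r_ n) (c + h) by near: n; exact: nu.
have dn : free_boundary (f_ n) (g_ n) (r_ n) (c - h) < 0 by near: n; exact: nd.
have Fltn := free_boundary_ltr _ _ _ _ (dfg_ n) (g_noninc_ n) (m0_ n) (g_lb_ n) (r0_ n).
have cu : c_ n < c + h.
  rewrite ltNge; apply/negP; rewrite le_eqVlt => /predU1P[e1|].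
    by move: un; rewrite e1 Fn ltxx.
  move=> /Fltn; rewrite Fn => /(_ (ltW cph)) => FF.
  by have := lt_trans FF un; rewrite ltxx.
have cd : c - h < c_ n.
  rewrite ltNge; apply/negP; rewrite le_eqVlt => /predU1P[e1|].
    by move: dn; rewrite -e1 Fn ltxx.
  move=> /Fltn; rewrite Fn => /(_ (ltW cn0)) /lt_trans -/(_ _ dn).
  by rewrite ltxx.
rewrite ltr_norml; apply/andP; split; lra.
Unshelve. all: by end_near. Qed.

End threshold_cvg.

(** * Gaussian and exponential laws *)

Section density.
Context {R : realType} {d : measure_display} {T : measurableType d}.
Variables (mu nu : {measure set T -> \bar R}) (p : T -> R).
Hypothesis p_ge0 : forall x, 0 <= p x.
Hypothesis mp : measurable_fun setT p.
Hypothesis nuE : forall A, measurable A -> nu A = (\int[mu]_(x in A) (p x)%:E)%E.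

Import HBNNSimple.
Local Open Scope ereal_scope.

(** Monotone convergence along simple approximations on both sides, then linearity, reduces the
    identity to indicators of measurable sets, where it is [nuE]. *)
Lemma ge0_integral_density (f : T -> \bar R) :
  measurable_fun setT f -> (forall x, 0 <= f x) ->
  \int[nu]_x f x = \int[mu]_x (f x * (p x)%:E).
Proof.
move=> mf f0; pose h := nnsfun_approx measurableT mf.
have mpE : measurable_fun setT (EFin \o p) by exact/measurable_EFinP.
have -> : \int[nu]_x f x = lim (\int[nu]_x (EFin \o h n) x @[n --> \oo]).
  have fE x : f x = lim ((EFin \o h n) x @[n --> \oo]).
    by apply/esym/cvg_lim => //; exact: cvg_nnsfun_approx.
  under eq_integral do rewrite fE.
  apply: monotone_convergence => //.
  - by move=> n; exact/measurable_EFinP.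
  - by move=> n x _ /=; rewrite lee_fin.
  - by move=> x _ a b ab; rewrite lee_fin; exact/lefP/nd_nnsfun_approx.
have -> : \int[mu]_x (f x * (p x)%:E) =
    lim (\int[mu]_x ((EFin \o h n) x * (p x)%:E) @[n --> \oo]).
  have fg x : f x * (p x)%:E = lim ((EFin \o h n) x * (p x)%:E @[n --> \oo]).
    by apply/esym/cvg_lim => //; apply: cvgeZr => //; exact: cvg_nnsfun_approx.
  under eq_integral do rewrite fg.
  apply: monotone_convergence => [//| | |].
  - by move=> n; apply/emeasurable_funM => //; exact/measurable_EFinP.
  - by move=> n x _ /=; rewrite mule_ge0 ?lee_fin.
  - move=> x _ a b ab/=; rewrite lee_wpmul2r ?lee_fin//.
    exact/lefP/nd_nnsfun_approx.
suff suf n : \int[nu]_x (EFin \o h n) x =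
    \int[mu]_x ((EFin \o h n) x * (p x)%:E).
  by under eq_fun do rewrite suf.
transitivity (\int[nu]_x
   (\sum_(y \in range (h n)) (y * \1_(h n @^-1` [set y]) x)%:E)).
  by apply: eq_integral => t _; rewrite /= fimfunE -fsumEFin.
have indich r : measurable_fun setT (fun x => (r * \1_(h n @^-1` [set r]) x)%:E).
  by apply: (measurable_comp measurableT) => //; exact: measurable_funM.
rewrite ge0_integral_fsum//; last by move=> m y _; exact: nnfun_muleindic_ge0.
transitivity (\int[mu]_x (\sum_(y \in range (h n))
    (y * \1_(h n @^-1` [set y]) x)%:E * (p x)%:E)); last first.
  apply: eq_integral => x _.
  rewrite -ge0_mule_fsuml => [|y]; last exact: nnfun_muleindic_ge0.
  by rewrite fsumEFin // -(fimfunE _ x).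
rewrite ge0_integral_fsum//; last 2 first.
  - by move=> y; apply: emeasurable_funM.
  - by move=> m y _; rewrite mule_ge0 ?lee_fin// -lee_fin nnfun_muleindic_ge0.
apply: eq_fsbigr => r rhn.
under [LHS]eq_integral do rewrite EFinM.
rewrite integralZl_indic_nnsfun => //.
under [RHS]eq_integral do rewrite EFinM -muleA.
rewrite ge0_integralZl//.
- under [in RHS]eq_integral do rewrite muleC.
  rewrite [in RHS](eq_integral ((EFin \o p) \_ (h n @^-1` [set r]))); last first.
    by move=> x xE; rewrite epatch_indic.
  rewrite -integral_mkcondr setTI integral_indic// setIT; congr (_ * _).
  exact: nuE.
- by apply: emeasurable_funM => //; exact/measurable_EFinP.
- by move=> x _; rewrite mule_ge0 ?lee_fin.
- by rewrite lee_fin; move: rhn; rewrite inE => -[x _ <-].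
Qed.

End density.

(** * Invariance of Lebesgue measure under reflections *)

Section reflection.
Context {R : realType}.
Notation mu := (@lebesgue_measure R).

Definition reflect_at (c : R) : measurableTypeR R -> measurableTypeR R :=
  fun x => c - x.

Lemma measurable_reflect_at (c : R) : measurable_fun setT (reflect_at c).
Proof. exact: measurable_funB. Qed.

(** Lebesgue measure is determined by its values on half-open intervals, and the preimage of []a,
    b]] is [[c - b, c - a[], of the same length. *)
Lemma lebesgue_measure_reflect (c : R) (A : set R) : measurable A ->
  pushforward mu (reflect_at c) A = mu A.
Proof.
have mr := measurable_reflect_at c.
move=> mA; apply/esym.
pose r : {mfun measurableTypeR R >-> measurableTypeR R} :=
  HB.pack (reflect_at c) (isMeasurableFun.Build _ _ _ _ _ mr).
apply: (@lebesgue_measure_unique R (pushforward mu r)) => //= _ [[a b]] _ <-.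
rewrite /pushforward/=.
rewrite (_ : reflect_at c @^-1` _ = `[c - b, c - a[%classic); last first.
  apply/seteqP; split => x /=; rewrite !in_itv/= /reflect_at => /andP[? ?];
    apply/andP; split; lra.
rewrite !lebesgue_measure_itv/= !lte_fin.
rewrite (_ : (c - b < c - a) = (a < b)); last by rewrite ltrD2l ltrN2.
by case: ifP => // _; rewrite -!EFinB; congr EFin; ring.
Qed.

Lemma ge0_integral_reflect (c : R) (f : R -> \bar R) :
  measurable_fun setT f -> (forall x, 0 <= f x)%E ->
  (\int[mu]_x f x = \int[mu]_x f (c - x)%R)%E.
Proof.
move=> mf f0.
have mr := measurable_reflect_at c.
rewrite -[RHS]/(\int[mu]_(x in reflect_at c @^-1` setT) (f \o reflect_at c) x)%E.
rewrite -ge0_integral_pushforward//.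
by apply: eq_measure_integral => A mA _; apply/esym; exact: lebesgue_measure_reflect.
Qed.

End reflection.

(** * Centred normal laws: symmetry, unimodality, second moment *)

Section normal_law.
Context {R : realType}.
Notation mu := (@lebesgue_measure R).
Variable s : R.
Hypothesis s0 : 0 < s.
Notation N := (normal_prob (0 : R) s).
Notation pdf := (normal_pdf (0 : R) s).

Lemma ge0_integral_normal_prob (f : R -> \bar R) :
  measurable_fun setT f -> (forall x, 0 <= f x)%E ->
  (\int[N]_x f x = \int[mu]_x (f x * (pdf x)%:E))%E.
Proof.
move=> mf f0; apply: ge0_integral_density => //.
- exact: normal_pdf_ge0.
- exact: measurable_normal_pdf.
Qed.

Lemma normal_pdf_le (x y : R) : `|x| <= `|y| -> pdf y <= pdf x.
Proof.
move=> xy; rewrite !normal_pdfE ?gt_eqF// ler_pM2l ?normal_peak_gt0 ?gt_eqF//.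
rewrite /normal_fun ler_expR ler_pM2r ?invr_gt0 ?mulrn_wgt0 ?exprn_gt0//.
by rewrite lerN2 !subr0 -(real_normK (num_real x)) -(real_normK (num_real y)) ler_pXn2r ?nnegrE.
Qed.

Lemma normal_pdfN (x : R) : pdf (- x) = pdf x.
Proof. by apply/eqP; rewrite eq_le !normal_pdf_le ?normrN. Qed.

Lemma ge0_integral_normalN (f : R -> R) :
  measurable_fun setT f -> (forall x, 0 <= f x) ->
  (\int[N]_x (f (- x))%:E = \int[N]_x (f x)%:E)%E.
Proof.
move=> mf f0.
have mfN : measurable_fun setT (fun x : R => f (- x)).
  by apply: measurableT_comp => //; exact: measurable_oppr.
rewrite !ge0_integral_normal_prob; last 4 first.
- exact/measurable_EFinP.
- by move=> x; rewrite lee_fin.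
- exact/measurable_EFinP.
- by move=> x; rewrite lee_fin.
rewrite [RHS](ge0_integral_reflect 0); last 2 first.
- by apply: emeasurable_funM; apply/measurable_EFinP => //; exact: measurable_normal_pdf.
- by move=> x; rewrite mule_ge0// lee_fin ?normal_pdf_ge0.
by apply: eq_integral => x _; rewrite sub0r normal_pdfN.
Qed.

(* With [rho] the reflection exchanging the two integrands [u] and [v = u o rho],
   the difference of the integrals is half that of [(u - v) (pdf - pdf o rho)],
   a product of two factors of the same sign. *)
Lemma normal_unimodal (f : R -> R) (a x y : R) :
  measurable_fun setT f -> (forall z, 0 <= f z) ->
  (forall z w, `|z| <= `|w| -> f w <= f z) ->
  0 < a -> 0 <= x -> x <= y ->
  (\int[N]_b (f (y + a * b))%:E <= \int[N]_b (f (x + a * b))%:E)%E.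
Proof.
move=> mf f0 fle a0 x0 xy.
(* With this centre, [y + a (c - b) = - (x + a b)], so for the even function [f] the map
   [b -> c - b] exchanges the two integrands. *)
pose c := - ((x + y) / a).
have ac : a * c = - (x + y) by rewrite /c; field; rewrite gt_eqF.
have c0 : c <= 0 by rewrite oppr_le0 divr_ge0 ?(ltW a0)//; lra.
have fN z : f (- z) = f z by apply/eqP; rewrite eq_le !fle ?normrN.
have fR b : f (y + a * (c - b)) = f (x + a * b).
  by rewrite mulrBr ac -fN; congr f; ring.
have fR' b : f (x + a * (c - b)) = f (y + a * b).
  by rewrite mulrBr ac -fN; congr f; ring.
have mlin z : measurable_fun setT (fun b : R => f (z + a * b)).
  apply: measurableT_comp => //; apply: measurable_funD => //.
have mlinp z : measurable_fun setT (fun b : R => (f (z + a * b))%:E * (pdf b)%:E)%E.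
  by apply: emeasurable_funM; apply/measurable_EFinP => //; exact: measurable_normal_pdf.
have lin0 z b : (0 <= (f (z + a * b))%:E * (pdf b)%:E)%E.
  by rewrite mule_ge0// lee_fin ?normal_pdf_ge0.
have mcb : measurable_fun setT (fun b : R => c - b) by exact: measurable_funB.
have mlinp' z : measurable_fun setT (fun b : R => (f (z + a * b))%:E * (pdf (c - b))%:E)%E.
  apply: emeasurable_funM; apply/measurable_EFinP => //.
  by apply: measurableT_comp => //; exact: measurable_normal_pdf.
have lin0' z b : (0 <= (f (z + a * b))%:E * (pdf (c - b))%:E)%E.
  by rewrite mule_ge0// lee_fin ?normal_pdf_ge0.
rewrite !ge0_integral_normal_prob; last 4 first.
- exact/measurable_EFinP.
- by move=> b; rewrite lee_fin.
- exact/measurable_EFinP.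
- by move=> b; rewrite lee_fin.
(* The doubled integrals are compared by sums only, which is meaningful for infinite values; a
   difference of integrals might not be. *)
have dbl (u v : \bar R) : (u + u <= v + v -> u <= v)%E.
  move: u v => [u| |] [v| |]; rewrite ?leey ?leNye//.
  by rewrite -!EFinD !lee_fin; lra.
apply: dbl.
have E z w : (forall b, f (w + a * (c - b)) = f (z + a * b)) ->
   (\int[mu]_b ((f (w + a * b))%:E * (pdf b)%:E) =
    \int[mu]_b ((f (z + a * b))%:E * (pdf (c - b))%:E))%E.
  move=> h; rewrite (ge0_integral_reflect c)//.
  by apply: eq_integral => b _; rewrite h.
rewrite [X in (_ + X <= _)%E](E x y fR) [X in (_ <= _ + X)%E](E y x fR') -!ge0_integralD//; do ?[exact: mlinp|exact: mlinp'].
apply: ge0_le_integral => //.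
- by move=> b _; rewrite adde_ge0.
- by apply: emeasurable_funD; [exact: mlinp|exact: mlinp'].
- by apply: emeasurable_funD; [exact: mlinp|exact: mlinp'].
- move=> b _; rewrite -!EFinM -!EFinD lee_fin.
  set u := f (x + _); set v := f (y + _); set p := pdf b; set q := pdf (c - b).
  have : 0 <= (u - v) * (p - q).
    (* The sign of [x + y + 2 a b] settles both comparisons at once: [|x + a b|] against
       [|y + a b|], and [|b|] against [|c - b|]. *)
    have [h|h] := leP 0 ((x + y) + 2 * (a * b)).
    - apply: mulr_ge0; rewrite subr_ge0.
        apply: fle; rewrite [X in _ <= X]ger0_norm; last by lra.
        by rewrite ler_norml; apply/andP; split; lra.
      apply: normal_pdf_le.
      have h' : c <= 2 * b by rewrite -(ler_pM2l a0) ac; lra.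
      rewrite -[X in _ <= X]normrN [X in _ <= X]ger0_norm; last by lra.
      by rewrite ler_norml; apply/andP; split; lra.
    - apply: mulr_le0; rewrite subr_le0.
        apply: fle; rewrite -[X in _ <= X]normrN [X in _ <= X]ger0_norm; last by lra.
        by rewrite ler_norml; apply/andP; split; lra.
      apply: normal_pdf_le.
      have h' : 2 * b <= c by rewrite -(ler_pM2l a0) ac; lra.
      rewrite -[X in _ <= X]normrN [X in _ <= X]ger0_norm; last by lra.
      by rewrite ler_norml; apply/andP; split; lra.
  lra.
Qed.

(** The Gaussian factor is split as [e * e] with [e = exp (- x^2 / (4 s^2))]. One factor absorbs
    [x^2] through [x^2 e <= 4 s^2]; the other is, up to its peak, the density of variance [2 s^2].
    The peaks differ by [sqrt 2], bounded by 2, whence the constant 8. *)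
Lemma normal_second_moment_ub :
  (\int[N]_x (x ^+ 2)%:E <= (8 * s ^+ 2)%:E)%E.
Proof.
have sN0 : s != 0 by rewrite gt_eqF.
pose s' := Num.sqrt 2 * s.
have s'2 : s' ^+ 2 = 2 * s ^+ 2 by rewrite exprMn sqr_sqrtr.
have s'0 : 0 < s' by rewrite mulr_gt0 ?sqrtr_gt0.
have pk : normal_peak s <= 2 * normal_peak s'.
  rewrite -(ler_pXn2r (n:=2))// ?nnegrE ?mulr_ge0 ?normal_peak_ge0//.
  have s2pi : 0 <= s ^+ 2 * pi by rewrite mulr_ge0 ?sqr_ge0 ?pi_ge0.
  rewrite exprMn /normal_peak !exprVn !sqr_sqrtr ?s'2; last 2 first.
  - by rewrite -mulrA; lra.
  - by lra.
  set q := s ^+ 2 * pi *+ 2.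
  have q0 : 0 < q by rewrite mulrn_wgt0// mulr_gt0 ?pi_gt0 ?exprn_gt0.
  have -> : 2 * s ^+ 2 * pi *+ 2 = 2 * q by rewrite /q; ring.
  rewrite invfM mulrA ler_peMl ?invr_ge0 ?(ltW q0)//; lra.
rewrite ge0_integral_normal_prob; last 2 first.
- by apply/measurable_EFinP; exact: exprn_measurable.
- by move=> x; rewrite lee_fin sqr_ge0.
apply: (@le_trans _ _ (\int[mu]_x ((8 * s ^+ 2)%:E * (normal_pdf 0 s' x)%:E))%E).
  apply: ge0_le_integral => //.
  - by move=> x _; rewrite mule_ge0// lee_fin ?normal_pdf_ge0 ?sqr_ge0.
  - apply: emeasurable_funM; apply/measurable_EFinP; last exact: measurable_normal_pdf.
    exact: exprn_measurable.
  - apply: emeasurable_funM => //; apply/measurable_EFinP.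
    exact: measurable_normal_pdf.
  - move=> x _; rewrite -!EFinM lee_fin !normal_pdfE ?(gt_eqF s'0)//.
    rewrite /normal_fun !subr0 s'2.
    set e := expR (- x ^+ 2 / (2 * s ^+ 2 *+ 2)).
    have -> : expR (- x ^+ 2 / (s ^+ 2 *+ 2)) = e * e.
      by rewrite -expRD; congr expR; field.
    have e0 : 0 < e by exact: expR_gt0.
    have s20 : 0 < s ^+ 2 by rewrite exprn_gt0.
    (* [z <= exp z] at [z = x^2 / (4 s^2)] *)
    have xe : x ^+ 2 * e <= 4 * s ^+ 2.
      rewrite /e mulNr expRN ler_pdivrMr ?expR_gt0//.
      have -> : 2 * s ^+ 2 *+ 2 = 4 * s ^+ 2 by ring.
      set z := _ / _; have -> : x ^+ 2 = 4 * s ^+ 2 * z.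
        by rewrite /z; field.
      rewrite ler_pM2l ?mulr_gt0//.
      by have := expR_ge1Dx z; lra.
    have -> : x ^+ 2 * (normal_peak s * (e * e)) = (x ^+ 2 * e) * (normal_peak s * e).
      by ring.
    apply: (@le_trans _ _ (4 * s ^+ 2 * (normal_peak s * e))).
      by rewrite ler_wpM2r// mulr_ge0 ?normal_peak_ge0// ltW.
    have -> : 8 * s ^+ 2 * (normal_peak s' * e) = 4 * s ^+ 2 * (2 * normal_peak s' * e).
      by ring.
    by rewrite ler_pM2l ?mulr_gt0// ler_pM2r.
rewrite ge0_integralZl//.
- by rewrite integral_normal_pdf mule1.
- by apply/measurable_EFinP; exact: measurable_normal_pdf.
- by move=> x _; rewrite lee_fin normal_pdf_ge0.
- by rewrite lee_fin mulr_ge0// sqr_ge0.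
Qed.

End normal_law.

(** * Joint measurability of continuous processes *)

Section joint_measurability.
Context {R : realType} {d : measure_display} {T : measurableType d}.

(** Rounding time down to a multiple of [1 / (n + 1)] makes the process constant in time on
    countably many strips, hence jointly measurable; path continuity gives the pointwise limit. *)
Lemma measurable_fun_joint (Y : R -> T -> R) :
  (forall t, measurable_fun setT (Y t)) ->
  (forall w, continuous (Y ^~ w)) ->
  measurable_fun [set: T * R] (fun z => Y z.2 z.1).
Proof.
move=> mY cY.
pose q n (t : R) : R := (Num.floor (t * n.+1%:R))%:~R / n.+1%:R.
have n0 n : 0 < n.+1%:R :> R by rewrite ltr0n.
have q_le n t : t - n.+1%:R^-1 <= q n t <= t.
  have /andP[h1 h2] := floor_itv (t * n.+1%:R).
  rewrite /q ler_pdivrMr// h1 andbT ler_pdivlMr// mulrBl mulVf ?gt_eqF//.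
  by rewrite lerBlDr ltW//; move: h2; rewrite intrD.
have cvgq t : q n t @[n --> \oo] --> t.
  apply: (@squeeze_cvgr _ _ _ _ (fun n => t - n.+1%:R^-1) (cst t)).
  - by apply: nearW => n; exact: q_le.
  - rewrite -[X in _ --> X]subr0; apply: cvgB; first exact: cvg_cst.
    exact: cvg_harmonic.
  - exact: cvg_cst.
apply: (@measurable_fun_cvg _ _ _ _ (fun n z => Y (q n z.2) z.1)); last first.
  by move=> z _; exact: (cvg_comp (fun n => q n z.2) (Y ^~ z.1) (cvgq z.2) (cY z.1 z.2)).
move=> n _ A mA; rewrite setTI.
rewrite (_ : _ @^-1` A = \bigcup_(k : int)
   ((Y (k%:~R / n.+1%:R) @^-1` A) `*` `[k%:~R / n.+1%:R, (k + 1)%:~R / n.+1%:R[)); last first.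
  apply/seteqP; split => [[w t] /= YA|[w t] [k _] /= [YA]].
    exists (Num.floor (t * n.+1%:R)) => //=; split => //.
    by rewrite in_itv/= ler_pdivrMr// ltr_pdivlMr// floor_itv.
  rewrite in_itv/= ler_pdivrMr// ltr_pdivlMr// => kt.
  by rewrite /q (floor_def kt).
apply: countable_bigcupT_measurable => // k.
apply: measurableX => //.
by rewrite -[X in measurable X]setTI; exact: mY.
Qed.

End joint_measurability.

(** * The exponential law and its mean *)

Section exponential_law.
Context {R : realType}.
Variable alpha : R.
Hypothesis alpha0 : 0 < alpha.

(* The library's probability structure on [exponential_prob] depends on the
   positivity of the rate, which canonical inference cannot supply. *)
Definition exp_law : probability (measurableTypeR R) R :=
  ltac:(unshelve refine (exponential_prob alpha : probability _ _);
        exact: alpha0).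

Lemma ge0_integral_exp_law (f : R -> \bar R) :
  measurable_fun setT f -> (forall x, 0 <= f x)%E ->
  (\int[exp_law]_x f x =
   \int[lebesgue_measure]_x (f x * (exponential_pdf alpha x)%:E))%E.
Proof.
move=> mf f0; apply: ge0_integral_density => //.
- by move=> x; apply: exponential_pdf_ge0; exact: ltW.
- exact: measurable_exponential_pdf.
Qed.

(** Half of the exponential decay absorbs the factor [t], since
    [(alpha / 2) t exp (- (alpha / 2) t) <= 1]; what remains is a multiple of the exponential
    density of rate [alpha / 2]. *)
Lemma exp_law_mean_lty :
  (\int[exp_law]_t (Num.max t 0)%:E < +oo)%E.
Proof.
have mmax : measurable_fun setT (fun t : R => Num.max t 0).
  exact: measurable_maxr.
rewrite (ge0_integral_exp_law (fun t => (Num.max t 0)%:E)); last 2 first.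
- exact/measurable_EFinP.
- by move=> t; rewrite lee_fin le_max lexx orbT.
have a2 : 0 < alpha / 2 by rewrite divr_gt0.
apply: (@le_lt_trans _ _ (\int[lebesgue_measure]_t
    ((4 / alpha)%:E * (exponential_pdf (alpha / 2) t)%:E))%E).
  apply: ge0_le_integral => //.
  - move=> t _; rewrite mule_ge0// lee_fin ?le_max ?lexx ?orbT//.
    by rewrite exponential_pdf_ge0// ltW.
  - apply: emeasurable_funM; apply/measurable_EFinP => //.
    exact: measurable_exponential_pdf.
  - apply: emeasurable_funM => //; apply/measurable_EFinP.
    exact: measurable_exponential_pdf.
  - move=> t _; rewrite -!EFinM lee_fin.
    have [t0|t0] := ltP t 0.
      by rewrite !lt0_exponential_pdf// !mulr0.
    rewrite !exponential_pdfE//.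
    set e := expR (- (alpha / 2) * t).
    have -> : expR (- alpha * t) = e * e by rewrite -expRD; congr expR; lra.
    have e0 : 0 < e by exact: expR_gt0.
    have te : alpha / 2 * t * e <= 1.
      rewrite /e mulNr expRN ler_pdivrMr ?expR_gt0// mul1r.
      by have := expR_ge1Dx (alpha / 2 * t); lra.
    have -> : 4 / alpha * (alpha / 2 * e) = 2 * e by field; rewrite gt_eqF.
    have -> : t * (alpha * (e * e)) = 2 * (alpha / 2 * t * e) * e by field.
    by rewrite ler_pM2r//; lra.
rewrite ge0_integralZl//.
- by rewrite integral_exponential_pdf// mule1 ltry.
- by apply/measurable_EFinP; exact: measurable_exponential_pdf.
- by move=> t _; rewrite lee_fin exponential_pdf_ge0// ltW.
- by rewrite lee_fin divr_ge0// ltW.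
Qed.

End exponential_law.

(** * Brownian motion at an exponential time *)

Section brownian_occupation.
Context {R : realType} {d : measure_display} {T : measurableType d}.
Context {P : probability T R} {B : R -> {RV P >-> R}}.
Hypothesis hB : standard_brownian_motion B.
Variable alpha : R.
Hypothesis alpha0 : 0 < alpha.
Notation E := (exp_law alpha alpha0).

(* Evaluated under [occupation_law], this is Brownian motion at an independent
   exponential time; the truncation discards the negative times, where [B] is
   unconstrained. *)
Definition killed_path (z : T * measurableTypeR R) : R := B (Num.max z.2 0) z.1.

Definition occupation_law : probability (T * measurableTypeR R)%type R := (P \x E)%E.

(** The truncated time stays in [[0, +oo[], where paths are continuous, so [t -> B (max t 0) w] is
    continuous on the whole line. *)
Lemma measurable_killed_path : measurable_fun setT killed_path.
Proof.
apply: (measurable_fun_joint (fun t => B (Num.max t 0))); first by move=> t.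
move=> w t; have := @bm_continuous _ _ _ _ _ hB w => /subspace_continuousP.
have m0 : 0 <= Num.max t 0 by rewrite le_max lexx orbT.
move=> /(_ (Num.max t 0)); rewrite /= in_itv/= andbT m0 => /(_ isT).
move=> h; refine (cvg_comp (fun t : R => Num.max t 0) (fun u => B u w) _ h).
move=> A /=.
have cm : (fun t : R => Num.max t 0) @ t --> Num.max t 0.
  by apply: continuous_max => //; exact: cvg_cst.
move=> /cm; apply: (@filterS _ (nbhs t)) => s /=; apply.
by rewrite in_itv/= andbT le_max lexx orbT.
Qed.

(** Time 0 is treated apart, because [normal_prob 0 0] is not the Dirac mass at 0. *)
Lemma integral_brownian0 (f : R -> \bar R) : measurable_fun setT f ->
  (forall x, 0 <= f x)%E -> (\int[P]_w f (B 0%R w) = f 0%R)%E.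
Proof.
move=> mf f0.
rewrite (@ge0_ae_eq_integral _ _ _ P setT _ (cst (f 0)))//.
- by rewrite integral_cst// [X in (_ * X)%E](@probability_setT _ _ _ P) mule1.
- exact: measurableT_comp.
- by move=> *; exact: f0.
- by have := bm_start hB; apply: filterS => w /= ->.
Qed.

(** Almost surely [B t] equals the increment [B t - B 0], whose law is prescribed. *)
Lemma integral_brownian t (f : R -> \bar R) : 0 < t -> measurable_fun setT f ->
  (forall x, 0 <= f x)%E ->
  (\int[P]_w f (B t w) = \int[normal_prob 0%R (Num.sqrt t)]_x f x)%E.
Proof.
move=> t0 mf f0.
have mD : @measurable_fun _ _ T (measurableTypeR R) setT (fun w => B t w - B 0 w).
  exact: measurable_funB.
pose D : {mfun T >-> measurableTypeR R} := HB.pack (fun w => B t w - B 0 w : measurableTypeR R)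
  (isMeasurableFun.Build _ _ _ _ _ mD).
rewrite (@ge0_ae_eq_integral _ _ _ P setT _ (f \o D))//; first last.
- by have := bm_start hB; apply: filterS => w /= w0 _; rewrite /D/= w0 subr0.
- by move=> w _; exact: f0.
- exact: measurableT_comp.
- exact: measurableT_comp.
transitivity (\int[pushforward P D]_x f x)%E.
  by rewrite ge0_integral_pushforward.
apply: (@eq_measure_integral _ (measurableTypeR R) R setT (normal_prob 0 (Num.sqrt t)) (pushforward P D) f) => A mA _.
by rewrite -[t in RHS]subr0; exact: bm_gaussian hB _ _ _ _ _ mA.
Qed.

Lemma integral_occupation (f : R -> R) : measurable_fun setT f ->
  (forall x, 0 <= f x) ->
  (\int[occupation_law]_z (f (killed_path z))%:E =
   \int[E]_t \int[P]_w (f (B (Num.max t 0) w))%:E)%E.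
Proof.
move=> mf f0.
apply: (@fubini_tonelli2 _ _ _ _ _ P E (fun z => (f (killed_path z))%:E)).
  apply/measurable_EFinP; apply: measurableT_comp => //.
  exact: measurable_killed_path.
by move=> z; rewrite lee_fin.
Qed.

Lemma measurable_brownian_mean (f : R -> R) : measurable_fun setT f ->
  (forall x, 0 <= f x) ->
  measurable_fun setT (fun t : R => \int[P]_w (f (B (Num.max t 0) w))%:E)%E.
Proof.
move=> mf f0.
apply: (measurable_fun_fubini_tonelli_G (fun z => (f (killed_path z))%:E)).
  apply/measurable_EFinP; apply: measurableT_comp => //.
  exact: measurable_killed_path.
by move=> z; rewrite lee_fin.
Qed.

(** Lifts comparisons under centred normal laws to the occupation law: by Tonelli it suffices to
    compare at each fixed time. Truncated time 0 contributes a point mass, hence the separate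
    hypothesis [f 0 <= g 0]. *)
Lemma le_integral_occupation (f g : R -> R) :
  measurable_fun setT f -> (forall x, 0 <= f x) ->
  measurable_fun setT g -> (forall x, 0 <= g x) ->
  f 0 <= g 0 ->
  (forall s : R, (0 < s)%R ->
    \int[normal_prob 0%R s]_x (f x)%:E <= \int[normal_prob 0%R s]_x (g x)%:E)%E ->
  (\int[occupation_law]_z (f (killed_path z))%:E <=
   \int[occupation_law]_z (g (killed_path z))%:E)%E.
Proof.
move=> mf f0 mg g0 fg0 fg; rewrite !integral_occupation//.
apply: ge0_le_integral => //.
- by move=> t _; apply: integral_ge0 => w _; rewrite lee_fin.
- exact: measurable_brownian_mean.
- exact: measurable_brownian_mean.
move=> t _; have [t0|t0] := leP t 0.
  have mean0 (k : R -> R) : measurable_fun setT k -> (forall x, 0 <= k x) ->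
      (\int[P]_w (k (B 0%R w))%:E = (k 0%R)%:E)%E.
    move=> mk k0; apply: (integral_brownian0 (EFin \o k)).
      exact/measurable_EFinP.
    by move=> x; rewrite /= lee_fin.
  by rewrite !mean0// lee_fin.
have mean (k : R -> R) : measurable_fun setT k -> (forall x, 0 <= k x) ->
    (\int[P]_w (k (B t w))%:E =
     \int[normal_prob 0%R (Num.sqrt t)]_x (k x)%:E)%E.
  move=> mk k0; apply: (integral_brownian _ (EFin \o k)) => //.
    exact/measurable_EFinP.
by rewrite (mean f)// (mean g)//; apply: fg; rewrite sqrtr_gt0.
Qed.

(** At time [t] the second moment is at most [8 t], and the exponential time has finite mean. *)
Lemma integrable_killed_path_sqr :
  occupation_law.-integrable setT (fun z => (killed_path z ^+ 2)%:E).
Proof.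
have mX := measurable_killed_path.
apply/integrableP; split.
  by apply/measurable_EFinP; exact: measurable_funX.
under eq_integral do rewrite gee0_abs ?lee_fin ?sqr_ge0//.
have msq : measurable_fun setT (fun x : R => x ^+ 2) by exact: exprn_measurable.
have sq0 x : 0 <= x ^+ 2 :> R by exact: sqr_ge0.
rewrite (integral_occupation (fun x => x ^+ 2))//.
have mmax : measurable_fun setT (fun t : R => Num.max t 0).
  exact: measurable_maxr.
apply: (@le_lt_trans _ _ (\int[E]_t (8%:E * (Num.max t 0)%:E))%E).
  apply: ge0_le_integral => //.
  - by move=> t _; apply: integral_ge0 => w _; rewrite lee_fin.
  - exact: (measurable_brownian_mean (fun x => x ^+ 2)).
  - by apply: emeasurable_funM => //; exact/measurable_EFinP.
  move=> t _; have [t0|t0] := leP t 0.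
    rewrite (integral_brownian0 (fun x => (x ^+ 2)%:E)) ?expr0n/= ?mule0//.
    exact/measurable_EFinP.
  rewrite (integral_brownian _ (fun x => (x ^+ 2)%:E))//.
    rewrite -EFinM -[t in leRHS]sqr_sqrtr ?(ltW t0)//.
    by apply: normal_second_moment_ub; rewrite sqrtr_gt0.
  exact/measurable_EFinP.
rewrite ge0_integralZl//.
- by rewrite lte_mul_pinfty// exp_law_mean_lty.
- exact/measurable_EFinP.
- by move=> t _; rewrite lee_fin le_max lexx orbT.
Qed.

(** The weight [exp (- alpha t)] is [alpha^-1] times the exponential density, and Tonelli turns the
    iterated integral into one over the product. *)
Lemma discounted_meanE (g : R -> R) : measurable_fun setT g ->
  (forall x, 0 <= g x) ->
  discounted_mean P B alpha g =
  alpha^-1 * fine (\int[occupation_law]_z (g (killed_path z))%:E)%E.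
Proof.
move=> mg g0; rewrite /discounted_mean.
have mgX : measurable_fun setT (fun z => (g (killed_path z))%:E).
  apply/measurable_EFinP; apply: measurableT_comp => //.
  exact: measurable_killed_path.
have inner w : (\int[lebesgue_measure]_(t in `[0%R, +oo[)
      (expR (- (alpha * t)) * g (B t w))%R%:E =
    (alpha^-1)%:E * \int[E]_t (g (killed_path (w, t)))%:E)%E.
  have mgw : measurable_fun setT (fun t : R => (g (killed_path (w, t)))%:E).
    exact: (measurable_fun_pair2 w mgX).
  rewrite (ge0_integral_exp_law _ _ (fun t => (g (killed_path (w, t)))%:E))//; last first.
    by move=> t; rewrite lee_fin.
  rewrite -ge0_integralZl//; last 3 first.
  - apply: emeasurable_funM => //; apply/measurable_EFinP.
    exact: measurable_exponential_pdf.
  - by move=> t _; rewrite mule_ge0// lee_fin// exponential_pdf_ge0// ltW.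
  - by rewrite lee_fin invr_ge0 ltW.
  rewrite [LHS]integral_mkcond; apply: eq_integral => t _.
  rewrite patchE; case: ifPn => [|/negP].
    rewrite inE/= in_itv/= andbT => t0.
    rewrite exponential_pdfE// /killed_path/= max_l// -!EFinM; congr EFin.
    by rewrite -mulNr; field; rewrite gt_eqF.
  rewrite inE/= in_itv/= andbT => /negP; rewrite -ltNge => t0.
  by rewrite lt0_exponential_pdf// !mule0.
under eq_integral do rewrite inner.
rewrite ge0_integralZl//; last 3 first.
- apply: (measurable_fun_fubini_tonelli_F (fun z => (g (killed_path z))%:E)) => //.
  by move=> z; rewrite lee_fin.
- by move=> w _; apply: integral_ge0 => t _; rewrite lee_fin.
- by rewrite lee_fin invr_ge0 ltW.
rewrite -(fubini_tonelli1 (fun z => (g (killed_path z))%:E))//; last first.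
  by move=> z; rewrite lee_fin.
set I := integral _ _ _.
(* If the integral is infinite, [fine] sends both sides to 0 and the identity still holds. *)
have : (0 <= I)%E by apply: integral_ge0 => z _; rewrite lee_fin.
case: I => [r _|_|//]; first by [].
by rewrite gt0_muley ?lte_fin ?invr_gt0//= mulr0.
Qed.

End brownian_occupation.

(** * Derivatives of the expected cost *)

Section derivatives.
Context {R : realType}.
Implicit Types x : R.

Lemma is_derive_continuous (f f' : R -> R) :
  (forall x, is_derive x 1 f (f' x)) -> continuous f.
Proof.
move=> df x; apply/differentiable_continuous/derivable1_diffP.
by have [] := df x.
Qed.

Lemma is_derive_measurable (f f' : R -> R) :
  (forall x, is_derive x 1 f (f' x)) -> measurable_fun setT f.
Proof.
by move=> df; apply: continuous_measurable_fun; exact: is_derive_continuous df.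
Qed.

(** A derivative is the pointwise limit of the difference quotients of step [1 / (n + 1)], which are
    measurable. *)
Lemma measurable_derivative (f f' : R -> R) :
  (forall x, is_derive x 1 f (f' x)) -> measurable_fun setT f'.
Proof.
move=> df.
have mf := is_derive_measurable _ _ df.
pose q n (x : R) : R := n.+1%:R * (f (n.+1%:R^-1 + x) - f x).
apply: (@measurable_fun_cvg _ _ R setT q).
  move=> n; apply: measurable_funM => //; apply: measurable_funB => //.
  by apply: measurableT_comp => //; exact: measurable_funD.
move=> x _; have [dx <-] := df x.
move: dx => /cvg_ex[l dl]; have -> : 'D_1 f x = l by exact/cvg_lim.
have harm : (forall n : nat, n.+1%:R^-1 != 0 :> R) /\ n.+1%:R^-1 @[n --> \oo] --> (0 : R).
  by split; [move=> n; rewrite invr_eq0 pnatr_eq0|exact: cvg_harmonic].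
move/cvgr_dnbhsP : dl => /(_ _ harm).
apply: cvg_trans; apply: near_eq_cvg; apply: nearW => n.
by rewrite /q /= invrK /GRing.scale/= mulr1.
Qed.

Lemma is_derive_derive1 (f f' : R -> R) :
  (forall x, is_derive x 1 f (f' x)) -> derive1 f = f'.
Proof. by move=> df; apply/funext => x; rewrite derive1E; have [_ ->] := df x. Qed.

Lemma is_derive_unique (f : R -> R) x (u v : R) :
  is_derive x 1 f u -> is_derive x 1 f v -> u = v.
Proof. by move=> [_ <-] [_ <-]. Qed.

Lemma is_derive_comp_opp (f f' : R -> R) :
  (forall x, is_derive x 1 f (f' x)) ->
  forall x, is_derive x 1 (fun y => f (- y)) (- f' (- x)).
Proof.
move=> df x; have := @is_derive1_comp R f -%R x _ (-1) (df (- x)) _.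
by rewrite mulrN1; exact.
Qed.

Lemma derivative_of_even (f f' : R -> R) : (forall x, f (- x) = f x) ->
  (forall x, is_derive x 1 f (f' x)) -> forall x, f' (- x) = - f' x.
Proof.
move=> fN df x; have := is_derive_comp_opp _ _ df x.
rewrite (_ : (fun y => f (- y)) = f); last exact/funext.
by move=> dN; rewrite -(is_derive_unique _ _ _ _ dN (df x)) opprK.
Qed.

Lemma derivative_of_odd (f f' : R -> R) : (forall x, f (- x) = - f x) ->
  (forall x, is_derive x 1 f (f' x)) -> forall x, f' (- x) = f' x.
Proof.
move=> fN df x; have := is_derive_comp_opp _ _ df x.
rewrite (_ : (fun y => f (- y)) = - f); last exact/funext.
have dN : is_derive x 1 (- f) (- f' x) by exact: is_deriveN.
by move=> dE; apply: oppr_inj; exact: is_derive_unique dE dN.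
Qed.

Lemma odd_at0 (f : R -> R) : (forall x, f (- x) = - f x) -> f 0 = 0.
Proof. by move=> /(_ 0); rewrite oppr0; lra. Qed.

Lemma derivative_lipschitz (f f' : R -> R) K :
  (forall x, is_derive x 1 f (f' x)) -> (forall x, 0 <= f' x <= K) ->
  forall x y, `|f x - f y| <= K * `|x - y|.
Proof.
move=> df f'K.
have H x y : x < y -> `|f x - f y| <= K * `|x - y|.
  move=> xy; have [c _ e] := is_derive_MVT _ _ _ _ xy (fun z _ => df z).
  rewrite distrC [`|x - y|]distrC e normrM ler_wpM2r//.
  by have /andP[h1 h2] := f'K c; rewrite ger0_norm.
move=> x y; have [xy|xy|->] := ltgtP x y; first exact: H.
  by rewrite distrC [`|x - y|]distrC; exact: H.
by rewrite !subrr normr0 mulr0.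
Qed.

End derivatives.

(** * Symmetry and growth of the cost and its derivatives *)

Section cost.
Context {R : realType}.
Variables (h : R -> R).
Hypothesis hh : admissible_cost h.
Implicit Types x : R.
Local Notation h1 := (derive1 h).
Local Notation h2 := (derive1n 2 h).

Lemma cost_is_derive x : is_derive x 1 h (h1 x).
Proof. by rewrite derive1E; apply: derivableP; exact: (cost_derivable hh). Qed.

Lemma cost_is_derive2 x : is_derive x 1 h1 (h2 x).
Proof.
have -> : h2 x = 'D_1 h1 x by rewrite -derive1E.
by apply: derivableP; exact: (cost_derivable2 hh).
Qed.

Lemma cost_derive_odd x : h1 (- x) = - h1 x.
Proof. exact: (derivative_of_even _ _ (cost_even hh) cost_is_derive). Qed.

Lemma cost_derive0 : h1 0 = 0.
Proof. exact: (odd_at0 _ cost_derive_odd). Qed.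

Lemma cost_derive2_even x : h2 (- x) = h2 x.
Proof. exact: (derivative_of_odd _ _ cost_derive_odd cost_is_derive2). Qed.

Lemma cost_derive2_le x (y : R) : `|x| <= `|y| -> h2 y <= h2 x.
Proof.
have abs z : h2 z = h2 `|z|.
  have [z0|z0] := leP 0 z; first by rewrite ger0_norm.
  by rewrite (ltr0_norm z0); exact: (esym (cost_derive2_even z)).
by rewrite (abs x) (abs y); apply: (cost_curvature_noninc hh).
Qed.

Section bounded_curvature.
Variable K : R.
Hypothesis hK : forall x, 0 <= h2 x <= K.

Lemma cost_derive_ub x : `|h1 x| <= K * `|x|.
Proof.
have := derivative_lipschitz _ _ K cost_is_derive2 hK x 0.
by rewrite cost_derive0 !subr0.
Qed.

(** By evenness [x > 0] may be assumed. Two mean value steps give [h x = h 0 + h1 c * x] with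
    [0 <= h1 c <= K x]. *)
Lemma cost_bounds x : 0 <= h x <= h 0 + K * x ^+ 2.
Proof.
wlog x0 : x / 0 < x.
  move=> H; have [x0|x0|<-] := ltgtP 0 x; first exact: H.
    by rewrite -(cost_even hh) -sqrrN; apply: H; rewrite oppr_gt0.
  by rewrite expr0n/= mulr0 addr0 lexx andbT cost_ge0.
have [c /andP[c0 cx]] := is_derive_MVT _ _ _ _ x0 (fun z _ => cost_is_derive z).
rewrite subr0 => e.
have [b _] := is_derive_MVT _ _ _ _ c0 (fun z _ => cost_is_derive2 z).
rewrite cost_derive0 !subr0 => eb.
have /andP[b0 bK] := hK b.
have K0 : 0 <= K by exact: le_trans bK.
have h1c : 0 <= h1 c <= K * x.
  rewrite eb mulr_ge0 ?(ltW c0)//=.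
  by apply: ler_pM => //; exact: ltW.
have h00 := cost_ge0 hh.
have -> : h x = h 0 + h1 c * x by rewrite -e; ring.
move: h1c => /andP[h1 h2]; apply/andP; split.
  by rewrite addr_ge0// mulr_ge0// ltW.
by rewrite lerD2l expr2 mulrA ler_pM2r.
Qed.

End bounded_curvature.

End cost.

(** * Differentiation under the expectation with quadratic growth *)

Section mean_cost.
Context {R : realType} {d : measure_display} {T : measurableType d}.
Variables (Q : probability T R) (X : T -> R).
Hypothesis mX : measurable_fun setT X.
Hypothesis X2 : Q.-integrable setT (fun w => (X w ^+ 2)%:E).
Implicit Types (a s x y C : R) (f : R -> R).

Lemma integrable_affine_sqr C y s :
  Q.-integrable setT (EFin \o (fun w => C * (1 + 2 * y ^+ 2 + 2 * s ^+ 2 * X w ^+ 2))).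
Proof.
apply: (eq_integrable measurableT
   (fun w => (C * (1 + 2 * y ^+ 2))%:E + (C * (2 * s ^+ 2))%:E * (X w ^+ 2)%:E)%E).
  by move=> w _; rewrite /= -EFinM -EFinD; congr EFin; ring.
apply: integrableD => //; first exact: finite_measure_integrable_cst.
exact: integrableZl.
Qed.

Lemma affine_sqr_le (C z w y s b : R) : 0 <= C -> `|y| <= `|w| -> z = y + s * b ->
  C * (1 + z ^+ 2) <= C * (1 + 2 * w ^+ 2 + 2 * s ^+ 2 * b ^+ 2).
Proof.
move=> C0 yw ->; rewrite ler_wpM2l// -addrA lerD2l.
have : y ^+ 2 <= w ^+ 2.
  by rewrite -(real_normK (num_real y)) -(real_normK (num_real w)) ler_pXn2r ?nnegrE.
have : 0 <= (y - s * b) ^+ 2 by exact: sqr_ge0.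
nra.
Qed.

Lemma measurable_affine f y s : measurable_fun setT f ->
  measurable_fun setT (fun w => f (y + s * X w)).
Proof.
move=> mf; apply: measurableT_comp => //; apply: measurable_funD => //.
exact: measurable_funM.
Qed.

Lemma integrable_affine f C y s : measurable_fun setT f -> 0 <= C ->
  (forall z, `|f z| <= C * (1 + z ^+ 2)) ->
  Q.-integrable setT (EFin \o (fun w => f (y + s * X w))).
Proof.
move=> mf C0 fC; apply: le_integrable (integrable_affine_sqr C y s) => //.
  by apply/measurable_EFinP; exact: measurable_affine.
move=> w _ /=; rewrite lee_fin (le_trans (fC _))//.
by rewrite (le_trans _ (ler_norm _))// (affine_sqr_le C _ y y s).
Qed.

Lemma is_derive_mean f f' C a s : 0 <= C ->
  (forall x, is_derive x 1 f (f' x)) ->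
  (forall z, `|f z| <= C * (1 + z ^+ 2)) ->
  (forall z, `|f' z| <= C * (1 + z ^+ 2)) ->
  forall x, is_derive x 1 (fun x => \int[Q]_w f (a * x + s * X w))%R
    (\int[Q]_w (a * f' (a * x + s * X w)))%R.
Proof.
move=> C0 df fC f'C x.
have mf := is_derive_measurable _ _ df.
pose g (x : R) w := f (a * x + s * X w).
have dg w y : is_derive y 1 (g ^~ w) (a * f' (a * y + s * X w)).
  have d1 : is_derive y 1 (fun y : R => a * y + s * X w) a.
    rewrite [X in is_derive _ _ X _](_ : _ = (a \*: (id : R -> R)) + cst (s * X w))//.
    by apply: is_derive_eq; rewrite /GRing.scale/= mulr1 addr0.
  rewrite [a * f' _]mulrC.
  exact: (@is_derive1_comp R f _ y _ _ (df (a * y + s * X w)) d1).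
have pg y w : partial1of2 g y w = a * f' (a * y + s * X w).
  by rewrite /partial1of2 derive1E; have [_ ->] := dg w y.
(* The dominating function on []x - 1, x + 1[]: there [|y| <= |x| + 1], and
   [(u + v)^2 <= 2 u^2 + 2 v^2] separates [y] from [X w]. It is integrable by the second moment of
   [X]. *)
pose G w := `|a| * C * (1 + 2 * (`|a| * (`|x| + 1)) ^+ 2 + 2 * s ^+ 2 * X w ^+ 2).
have xx : `]x - 1, x + 1[%classic x by rewrite /= in_itv/=; apply/andP; split; lra.
have intg y : `]x - 1, x + 1[%classic y -> Q.-integrable setT (EFin \o g y).
  by move=> _; exact: integrable_affine mf C0 fC.
have dg' y w : `]x - 1, x + 1[%classic y -> setT w -> derivable (g ^~ w) y 1.
  by move=> _ _; have [] := dg w y.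
have G0 w : 0 <= G w.
  rewrite mulr_ge0 ?(mulr_ge0 (normr_ge0 _) C0)//.
  apply: addr_ge0; last by rewrite mulr_ge0 ?sqr_ge0// mulr_ge0 ?sqr_ge0.
  by apply: addr_ge0 => //; rewrite mulr_ge0 ?sqr_ge0.
have iG : Q.-integrable setT (EFin \o G) by exact: integrable_affine_sqr.
have Gub y w : `]x - 1, x + 1[%classic y -> setT w -> `|partial1of2 g y w| <= G w.
  rewrite /= in_itv/= => /andP[y1 y2] _; rewrite pg normrM /G -mulrA ler_wpM2l//.
  rewrite (le_trans (f'C _))// (affine_sqr_le C _ _ (a * y) s)//.
  rewrite normrM [X in _ <= X]ger0_norm ?mulr_ge0 ?addr_ge0//.
  rewrite ler_wpM2l//.
  have := ler_norm x; have := ler_norm (- x); rewrite normrN => ? ?.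
  by rewrite ler_norml; apply/andP; split; lra.
have D := @derivable_under_integral R _ T Q g setT measurableT x _ _ xx intg dg' G G0 iG Gub.
have E := @differentiation_under_integral R _ T Q g setT measurableT x _ _ xx intg dg' G G0 iG Gub.
apply: DeriveDef; first exact: D.
rewrite -derive1E [LHS]E; apply: eq_Rintegral => w _; exact: pg.
Qed.

End mean_cost.

(** * Expected cost of a symmetric unimodal variable and its thresholds *)

Section value.
Context {R : realType} {d : measure_display} {T : measurableType d}.
Variables (Q : probability T R) (X : T -> R).
Hypothesis mX : measurable_fun setT X.
Hypothesis X2 : Q.-integrable setT (fun w => (X w ^+ 2)%:E).
Hypothesis X_symmetric : forall f : R -> R, measurable_fun setT f ->
  (forall z, 0 <= f z) ->
  (\int[Q]_w (f (- X w))%:E = \int[Q]_w (f (X w))%:E)%E.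
Hypothesis X_unimodal : forall (f : R -> R) (s x y : R), measurable_fun setT f ->
  (forall z, 0 <= f z) ->
  (forall z w : R, `|z| <= `|w| -> f w <= f z) ->
  0 < s -> 0 <= x -> x <= y ->
  (\int[Q]_w (f (y + s * X w)%R)%:E <= \int[Q]_w (f (x + s * X w)%R)%:E)%E.
Variables (h : R -> R) (alpha : R).
Hypotheses (hh : admissible_cost h) (alpha0 : 0 < alpha).
Implicit Types (a s x y z c lambda : R).
Local Notation h1 := (derive1 h).
Local Notation h2 := (derive1n 2 h).

(* [Q] is a probability, whereas discounting has total mass [alpha^-1]. *)
Definition value a s x := alpha^-1 * (\int[Q]_w h (a * x + s * X w))%R.
Definition value1 a s x := alpha^-1 * (\int[Q]_w (a * h1 (a * x + s * X w)))%R.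
Definition value2 a s x :=
  alpha^-1 * (\int[Q]_w (a * (a * h2 (a * x + s * X w))))%R.

Variables k K : R.
Hypothesis k0 : 0 < k.
Hypothesis hk : forall x, k < h2 x.
Hypothesis hK : forall x, h2 x <= K.

Let h2_bounds x : 0 <= h2 x <= K.
Proof. by rewrite hK (ltW (lt_trans k0 (hk x))). Qed.

Let K0 : 0 < K.
Proof. exact: lt_le_trans (lt_trans k0 (hk 0)) (hK 0). Qed.

Let mh : measurable_fun setT h.
Proof. exact: is_derive_measurable (cost_is_derive h hh). Qed.

Let mh1 : measurable_fun setT h1.
Proof. exact: is_derive_measurable (cost_is_derive2 h hh). Qed.

Let mh2 : measurable_fun setT h2.
Proof. exact: measurable_derivative (cost_is_derive2 h hh). Qed.

(** One constant for which [h], [h1] and [h2] are all bounded by [C (1 + x^2)]. *)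
Let C := h 0 + K.

Let C0 : 0 <= C.
Proof. by have := cost_ge0 hh; have := K0; rewrite /C; lra. Qed.

Lemma cost_ge0_everywhere x : 0 <= h x.
Proof. by have /andP[] := cost_bounds h hh K h2_bounds x. Qed.

Let h_ub x : `|h x| <= C * (1 + x ^+ 2).
Proof.
have /andP[h0 hu] := cost_bounds h hh K h2_bounds x; rewrite ger0_norm//.
have := cost_ge0 hh; have := K0; have := sqr_ge0 x; move: hu; rewrite /C; nra.
Qed.

Let h1_ub x : `|h1 x| <= C * (1 + x ^+ 2).
Proof.
have := cost_derive_ub h hh K h2_bounds x; move=> /le_trans; apply.
have xx : `|x| <= 1 + x ^+ 2.
  have := sqr_ge0 (`|x| - 1); have : `|x| ^+ 2 = x ^+ 2 by rewrite real_normK ?num_real.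
  nra.
have h00 := cost_ge0 hh.
apply: (@le_trans _ _ (K * (1 + x ^+ 2))); first by rewrite ler_pM2l.
by rewrite ler_wpM2r ?addr_ge0 ?sqr_ge0// /C lerDr.
Qed.

Let h2_ub x : `|h2 x| <= C * (1 + x ^+ 2).
Proof.
have /andP[h20 h2K] := h2_bounds x; rewrite ger0_norm//.
have h00 := cost_ge0 hh; have := K0; have := sqr_ge0 x; rewrite /C; nra.
Qed.

Let scale_ub a (f : R -> R) (D : R) : (forall x, `|f x| <= D * (1 + x ^+ 2)) ->
  forall x, `|a * f x| <= (`|a| * D) * (1 + x ^+ 2).
Proof. by move=> fD x; rewrite normrM -mulrA ler_wpM2l. Qed.

Let is_derive_scale a (f f' : R -> R) : (forall x, is_derive x 1 f (f' x)) ->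
  forall x, is_derive x 1 (fun x => a * f x) (a * f' x).
Proof. by move=> df x; exact: is_deriveZ. Qed.

Let aC0 a : 0 <= `|a| * C. Proof. by rewrite mulr_ge0. Qed.

Lemma is_derive_value a s x : is_derive x 1 (value a s) (value1 a s x).
Proof.
exact: (is_derive_scale alpha^-1 _ _ (is_derive_mean Q X mX X2 h h1 C a s C0
  (cost_is_derive h hh) h_ub h1_ub)).
Qed.

Lemma is_derive_value1 a s x : is_derive x 1 (value1 a s) (value2 a s x).
Proof.
exact: (is_derive_scale alpha^-1 _ _ (is_derive_mean Q X mX X2
  (fun z => a * h1 z) (fun z => a * h2 z) (`|a| * C) a s (aC0 a)
  (is_derive_scale a _ _ (cost_is_derive2 h hh))
  (scale_ub a _ _ h1_ub) (scale_ub a _ _ h2_ub))).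
Qed.

Lemma derive1_value a s : derive1 (value a s) = value1 a s.
Proof. by apply: is_derive_derive1; exact: is_derive_value. Qed.

Lemma derive2_value a s : derive1n 2 (value a s) = value2 a s.
Proof.
rewrite -[LHS]/(derive1 (derive1 (value a s))) derive1_value.
by apply: is_derive_derive1; exact: is_derive_value1.
Qed.

(** Evenness of [h] trades the sign of [x] for that of [X], whose law is symmetric. *)
Lemma valueN a s x : value a s (- x) = value a s x.
Proof.
rewrite /value; congr (_ * fine _).
have mf : measurable_fun setT (fun b : R => h (a * x + s * b)).
  apply: measurableT_comp => //; apply: measurable_funD => //.
have := X_symmetric (fun b => h (a * x + s * b)) mf.
move=> <-; last by move=> z; exact: cost_ge0_everywhere.
apply: eq_integral => w _; congr EFin.
by rewrite -(cost_even hh); congr h; ring.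
Qed.

Lemma value1_0 a s : value1 a s 0 = 0.
Proof.
apply: odd_at0; apply: (derivative_of_even (value a s)); first exact: valueN.
exact: is_derive_value.
Qed.

Let integrable_h2 a s x :
  Q.-integrable setT (EFin \o (fun w => a * (a * h2 (a * x + s * X w)))).
Proof.
apply: (integrable_affine Q X mX X2 (fun z => a * (a * h2 z)) (`|a| * (`|a| * C))).
- by apply: measurable_funM => //; exact: measurable_funM.
- by rewrite !mulr_ge0.
- by apply: scale_ub; exact: scale_ub.
Qed.

(** The integrand [a (a h2)] is nonnegative and radially nonincreasing, so unimodality of [X]
    applies; integrability allows passing to real values. *)
Lemma value2_noninc a s x y : 0 < a -> 0 < s -> 0 <= x -> x <= y ->
  value2 a s y <= value2 a s x.
Proof.
move=> a0 s0 x0 xy; rewrite /value2; apply: ler_wpM2l; first by rewrite invr_ge0 ltW.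
apply: fine_le.
- exact: integrable_fin_num (integrable_h2 a s y).
- exact: integrable_fin_num (integrable_h2 a s x).
have mf : measurable_fun setT (fun z => a * (a * h2 z)).
  by apply: measurable_funM => //; exact: measurable_funM.
have f0 z : 0 <= a * (a * h2 z).
  by have /andP[h20 _] := h2_bounds z; rewrite !mulr_ge0// ltW.
have fle z w : `|z| <= `|w| -> a * (a * h2 w) <= a * (a * h2 z).
  move=> zw; apply: ler_wpM2l; first exact: (ltW a0).
  by apply: ler_wpM2l; [exact: (ltW a0)|exact: (cost_derive2_le h hh z w zw)].
have ax : 0 <= a * x by rewrite mulr_ge0// ltW.
have axy : a * x <= a * y by rewrite ler_pM2l.
exact: (X_unimodal _ s _ _ mf f0 fle s0 ax axy).
Qed.

Lemma value2_ge a s x : alpha^-1 * (a ^+ 2 * k) <= value2 a s x.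
Proof.
rewrite /value2; apply: ler_wpM2l; first by rewrite invr_ge0 ltW.
have -> : a ^+ 2 * k = (\int[Q]_w (a ^+ 2 * k))%R.
  by rewrite Rintegral_cst// [X in fine X](@probability_setT _ _ _ Q) mulr1.
apply: le_Rintegral => //.
- exact: finite_measure_integrable_cst.
- by move=> w _; rewrite mulrA -expr2 ler_wpM2l ?sqr_ge0// ltW.
Qed.

Lemma threshold_value_exists_unique a s lambda : 0 < a -> 0 < s -> 0 < lambda ->
  exists! c, positive_solution lambda (value a s) c.
Proof.
move=> a0 s0 l0; rewrite /positive_solution.
rewrite derive1_value derive2_value.
have m0 : 0 < alpha^-1 * (a ^+ 2 * k).
  by rewrite mulr_gt0 ?invr_gt0// mulr_gt0// exprn_gt0.
have r0 : 0 < Num.sqrt lambda by rewrite sqrtr_gt0.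
exact: (threshold_exists_unique _ _ _ _ (value1_0 a s) (is_derive_value1 a s)
  (fun x y => value2_noninc a s x y a0 s0) m0 (value2_ge a s) r0).
Qed.

Lemma positive_solutionE a s lambda c : positive_solution lambda (value a s) c ->
  0 < c /\ 1 / Num.sqrt lambda * tanh (c * Num.sqrt lambda) =
    (value1 a s c - 1) / value2 a s c.
Proof.
rewrite /positive_solution.
by rewrite derive1_value derive2_value.
Qed.

Let integrable_h1 a s x :
  Q.-integrable setT (EFin \o (fun w => a * h1 (a * x + s * X w))).
Proof.
apply: (integrable_affine Q X mX X2 (fun z => a * h1 z) (`|a| * C)) => //.
- exact: measurable_funM.
- exact: scale_ub.
Qed.

(** Splitting off the factor [1 - a] and using that [h1] is [K]-Lipschitz bounds the difference of
    integrands by [2 K (1 - a) (|x| + |X|)]; [a <= s] gives [1 - s <= 1 - a], so a single parameter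
    controls the error. The function [G] is an integrable quadratic majorant of
    [2 K (|x| + |X|)]. *)
Lemma value1_dist x : exists M, forall a s, 0 <= a -> a <= s -> s <= 1 ->
  `|value1 a s x - value1 1 1 x| <= M * (1 - a).
Proof.
pose G w := 4 * K * (1 + 2 * x ^+ 2 + 2 * 1 ^+ 2 * X w ^+ 2).
have iG : Q.-integrable setT (EFin \o G) by exact: integrable_affine_sqr.
exists (alpha^-1 * (\int[Q]_w G w)%R) => a s a0 as1 s1.
rewrite /value1 -mulrBr normrM ger0_norm ?invr_ge0 ?(ltW alpha0)// -mulrA.
apply: ler_wpM2l; first by rewrite invr_ge0 ltW.
rewrite -RintegralB//; [|exact: integrable_h1..].
have iB : Q.-integrable setT (EFin \o (fun w =>
    a * h1 (a * x + s * X w) - 1 * h1 (1 * x + 1 * X w))).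
  rewrite /comp; under eq_fun do rewrite EFinB.
  by apply: integrableB => //; exact: integrable_h1.
apply: le_trans (le_normr_Rintegral _ _) _ => //.
rewrite -RintegralZr//.
have a1 : a <= 1 by exact: le_trans as1 s1.
apply: le_Rintegral => //.
- exact: integrable_norm.
- by rewrite /comp; under eq_fun do rewrite EFinM; exact: integrableZr.
move=> w _; set b := X w.
have lip := derivative_lipschitz _ _ K (cost_is_derive2 h hh) h2_bounds
  (a * x + s * b) (1 * x + 1 * b).
have ub := cost_derive_ub h hh K h2_bounds (a * x + s * b).
have n1 : `|a * x + s * b| <= `|x| + `|b|.
  rewrite (le_trans (ler_normD _ _))// lerD// normrM ger0_norm ?ler_piMl//.
  exact: le_trans as1.
have n2 : `|a * x + s * b - (1 * x + 1 * b)| <= (1 - a) * (`|x| + `|b|).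
  have -> : a * x + s * b - (1 * x + 1 * b) = - ((1 - a) * x + (1 - s) * b) by ring.
  rewrite normrN (le_trans (ler_normD _ _))// mulrDr lerD// normrM ger0_norm ?subr_ge0//.
  by rewrite ler_wpM2r// lerB.
have -> : a * h1 (a * x + s * b) - 1 * h1 (1 * x + 1 * b) =
  - ((1 - a) * h1 (a * x + s * b)) + (h1 (a * x + s * b) - h1 (1 * x + 1 * b)).
  by ring.
rewrite (le_trans (ler_normD _ _))// normrN normrM ger0_norm ?subr_ge0//.
have h1' : (1 - a) * `|h1 (a * x + s * b)| <= (1 - a) * (K * (`|x| + `|b|)).
  by rewrite ler_wpM2l ?subr_ge0// (le_trans ub)// ler_pM2l.
have h2' : `|h1 (a * x + s * b) - h1 (1 * x + 1 * b)| <= K * ((1 - a) * (`|x| + `|b|)).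
  by rewrite (le_trans lip)// ler_pM2l.
apply: le_trans (lerD h1' h2') _.
rewrite [G w * _]mulrC [K * (_ * _)]mulrCA -mulrDr ler_wpM2l ?subr_ge0//.
rewrite /G -/b expr1n mulr1.
have -> : K * (`|x| + `|b|) + K * (`|x| + `|b|) = K * (2 * (`|x| + `|b|)) by ring.
have -> : 4 * K * (1 + 2 * x ^+ 2 + 2 * b ^+ 2) =
  K * (4 * (1 + 2 * x ^+ 2 + 2 * b ^+ 2)) by ring.
rewrite ler_pM2l//.
have := sqr_ge0 (`|x| - 1); have : `|x| ^+ 2 = x ^+ 2 by rewrite real_normK ?num_real.
have := sqr_ge0 (`|b| - 1); have : `|b| ^+ 2 = b ^+ 2 by rewrite real_normK ?num_real.
have := sqr_ge0 x; have := sqr_ge0 b.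
nra.
Qed.

Lemma threshold_value_cvg (a_ s_ l_ c_ : nat -> R) lambda c :
  (forall n : nat, 0 < a_ n) -> (forall n : nat, a_ n <= s_ n <= 1) -> (forall n : nat, 0 < l_ n) ->
  0 < lambda -> a_ @ \oo --> (1 : R) -> l_ @ \oo --> lambda ->
  (forall n : nat, positive_solution (l_ n) (value (a_ n) (s_ n)) (c_ n)) ->
  positive_solution lambda (value 1 1) c ->
  c_ @ \oo --> c.
Proof.
move=> a0 as1 l0 lam0 cva cvl c_E cS.
have [c0 cE] := positive_solutionE _ _ _ _ cS.
have s0 n : 0 < s_ n.
  by have /andP[an _] := as1 n; exact: lt_le_trans an.
have m0 a : 0 < a -> 0 < alpha^-1 * (a ^+ 2 * k).
  by move=> a0'; rewrite mulr_gt0 ?invr_gt0// mulr_gt0// exprn_gt0.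
have r0 : 0 < Num.sqrt lambda by rewrite sqrtr_gt0.
have r0_ n : 0 < Num.sqrt (l_ n) by rewrite sqrtr_gt0.
have cvr : Num.sqrt (l_ n) @[n --> \oo] --> Num.sqrt lambda.
  by apply: cvg_comp cvl _; exact: sqrt_continuous.
have cvf x : value1 (a_ n) (s_ n) x @[n --> \oo] --> value1 1 1 x.
  have [M Mx] := value1_dist x.
  have bnd n : `|value1 (a_ n) (s_ n) x - value1 1 1 x| <= M * (1 - a_ n).
    by have /andP[? ?] := as1 n; apply: Mx => //; exact: ltW.
  have cvM : M * (1 - a_ n) @[n --> \oo] --> (0 : R).
    rewrite -(mulr0 M) -(subrr 1); apply: cvgM; first exact: cvg_cst.
    by apply: cvgB => //; exact: cvg_cst.
  apply: (@squeeze_cvgr _ _ _ _ (fun n => value1 1 1 x - M * (1 - a_ n))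
    (fun n => value1 1 1 x + M * (1 - a_ n))).
  - by apply: nearW => n; rewrite -ler_distl.
  - by rewrite -[X in _ --> X]subr0; apply: cvgB => //; exact: cvg_cst.
  - by rewrite -[X in _ --> X]addr0; apply: cvgD => //; exact: cvg_cst.
have nE : \forall n \near \oo, 0 < c_ n /\
    1 / Num.sqrt (l_ n) * tanh (c_ n * Num.sqrt (l_ n)) =
    (value1 (a_ n) (s_ n) (c_ n) - 1) / value2 (a_ n) (s_ n) (c_ n).
  by apply: nearW => n; exact: (positive_solutionE _ _ _ _ (c_E n)).
exact: (threshold_cvg _ _ _ _ (fun n => value1 (a_ n) (s_ n))
  (fun n => value2 (a_ n) (s_ n)) (fun n => alpha^-1 * (a_ n ^+ 2 * k)) _
  (is_derive_value1 1 1) (fun x y => value2_noninc 1 1 x y ltr01 ltr01)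
  (m0 1 ltr01) (value2_ge 1 1) r0 (fun n => is_derive_value1 (a_ n) (s_ n))
  (fun n x y => value2_noninc _ _ x y (a0 n) (s0 n)) (fun n => m0 _ (a0 n))
  (fun n => value2_ge (a_ n) (s_ n)) r0_ cvf cvr c_ c nE c0 cE).
Qed.

(** For the quadratic cost [value2] is the constant [2 a^2 / alpha] and [value1] is linear, so the
    right side of the threshold equation is [c - alpha / (2 a^2)], whatever [s] is. *)
Lemma quadratic_thresholdE a s lambda c : (forall x, h x = x ^+ 2) -> 0 < a ->
  positive_solution lambda (value a s) c ->
  0 < c /\ tanh_scaled (Num.sqrt lambda) c = c - alpha / (2 * a ^+ 2).
Proof.
move=> hE a0 cS; have [c0 cE] := positive_solutionE _ _ _ _ cS; split => //.
have dh x : is_derive x 1 h (2 * x).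
  rewrite [X in is_derive _ _ X _](_ : _ = (fun x : R => x ^+ 2)); last exact/funext.
  by apply: is_derive_eq; rewrite /GRing.scale/=; ring.
have h1E : h1 = (fun x => 2 * x) by exact: is_derive_derive1.
have h2E : h2 = (fun x => 2).
  rewrite -[LHS]/(derive1 h1) h1E; apply: is_derive_derive1 => x.
  rewrite -[X in is_derive _ _ _ X]mulr1.
  exact: (is_derive_scale 2 id (fun=> 1)).
have v2 x : value2 a s x = alpha^-1 * (a * (a * 2)).
  rewrite /value2 h2E; congr (_ * _).
  by rewrite Rintegral_cst// [X in fine X](@probability_setT _ _ _ Q) mulr1.
(* Linearity comes from the constant second derivative and [value1 a s 0 = 0], with no computation
   of the mean of [X]. *)
have v1 : value1 a s c = alpha^-1 * (a * (a * 2)) * c.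
  have [y _] := is_derive_MVT _ _ _ _ c0 (fun z _ => is_derive_value1 a s z).
  by rewrite value1_0 !subr0 v2.
rewrite /tanh_scaled cE v1 v2; field.
by rewrite !gt_eqF.
Qed.

End value.

(** * Symmetry and unimodality of the occupation law *)

Lemma occupation_symmetric (R : realType) (d : measure_display)
    (T : measurableType d) (P : probability T R) (B : R -> {RV P >-> R})
    (hB : standard_brownian_motion B) (alpha : R) (alpha0 : 0 < alpha)
    (f : R -> R) : measurable_fun setT f -> (forall z, 0 <= f z) ->
  (\int[@occupation_law R d T P alpha alpha0]_w (f (- killed_path (B:=B) w))%:E =
   \int[@occupation_law R d T P alpha alpha0]_w (f (killed_path (B:=B) w))%:E)%E.
Proof.
move=> mf f0.
have mfN : measurable_fun setT (fun x : R => f (- x)).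
  by apply: measurableT_comp => //; exact: measurable_oppr.
apply/eqP; rewrite eq_le; apply/andP; split.
- apply: (le_integral_occupation hB alpha alpha0 (fun x => f (- x)) f) => //.
    by rewrite oppr0.
  by move=> s s0; rewrite ge0_integral_normalN.
- apply: (le_integral_occupation hB alpha alpha0 f (fun x => f (- x))) => //.
    by rewrite oppr0.
  by move=> s s0; rewrite ge0_integral_normalN.
Qed.

Lemma occupation_unimodal (R : realType) (d : measure_display)
    (T : measurableType d) (P : probability T R) (B : R -> {RV P >-> R})
    (hB : standard_brownian_motion B) (alpha : R) (alpha0 : 0 < alpha)
    (f : R -> R) (s x y : R) : measurable_fun setT f -> (forall z, 0 <= f z) ->
  (forall z w : R, `|z| <= `|w| -> f w <= f z) ->
  0 < s -> 0 <= x -> x <= y ->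
  (\int[@occupation_law R d T P alpha alpha0]_w (f (y + s * killed_path (B:=B) w)%R)%:E <=
   \int[@occupation_law R d T P alpha alpha0]_w (f (x + s * killed_path (B:=B) w)%R)%:E)%E.
Proof.
move=> mf f0 fle s0 x0 xy.
have mlin z : measurable_fun setT (fun b : R => f (z + s * b)).
  by apply: measurableT_comp => //; exact: measurable_funD.
apply: (le_integral_occupation hB alpha alpha0 (fun b => f (y + s * b))
  (fun b => f (x + s * b))) => //.
  by rewrite mulr0 !addr0; apply: fle; rewrite !ger0_norm// (le_trans x0).
by move=> t t0; exact: normal_unimodal.
Qed.

(** * Dependence of the coefficients on the number of players *)

Section player_count.
Context {R : realType}.

(* The argument of [h] in [p_many] is [shrink N * x + spread N * b]. *)
Definition shrink (N : nat) : R := (N%:R - 1) / N%:R.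

Definition spread (N : nat) : R := shrink N * Num.sqrt (N%:R / (N%:R - 1)).

Lemma shrinkE n : shrink n.+2 = 1 - n.+2%:R^-1.
Proof. by rewrite /shrink mulrBl divff ?mul1r// pnatr_eq0. Qed.

Lemma shrink_gt0 n : 0 < shrink n.+2.
Proof. by rewrite divr_gt0 ?ltr0n// subr_gt0 ltr1n. Qed.

Lemma shrink_lt1 n : shrink n.+2 < 1.
Proof. by rewrite shrinkE ltrBlDr ltrDl invr_gt0 ltr0n. Qed.

Lemma shrink_ltr m n : (m < n)%N -> shrink m.+2 < shrink n.+2.
Proof.
by move=> mn; rewrite !shrinkE ltrD2l ltrN2 ltf_pV2 ?posrE ?ltr0n// ltr_nat.
Qed.

(** [spread N] is the square root of [shrink N], a number between 0 and 1. *)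
Lemma shrink_le_spread n : shrink n.+2 <= spread n.+2 <= 1.
Proof.
have a0 := shrink_gt0 n; have a1 := ltW (shrink_lt1 n).
have e : n.+2%:R / (n.+2%:R - 1) = (shrink n.+2)^-1 by rewrite /shrink invf_div.
have s2 : spread n.+2 ^+ 2 = shrink n.+2.
  rewrite /spread e exprMn sqr_sqrtr ?invr_ge0 ?ltW// expr2 mulfK//.
  by rewrite gt_eqF.
have s0 : 0 <= spread n.+2 by rewrite mulr_ge0 ?ltW.
have sq (x y : R) : 0 <= x -> 0 <= y -> x ^+ 2 <= y ^+ 2 -> x <= y.
  by move=> x0 y0; rewrite ler_pXn2r ?nnegrE.
apply/andP; split; apply: sq => //; rewrite ?s2 ?expr1n//; first exact: ltW.
by rewrite expr2 ler_piMl// ltW.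
Qed.

Lemma spread_gt0 n : 0 < spread n.+2.
Proof. by have /andP[h _] := shrink_le_spread n; exact: lt_le_trans (shrink_gt0 n) h. Qed.

Lemma cvg_shrink : shrink n.+2 @[n --> \oo] --> (1 : R).
Proof.
rewrite (_ : (fun n => shrink n.+2) = (fun n => 1 - n.+2%:R^-1)); last first.
  by apply/funext => n; exact: shrinkE.
rewrite -[X in _ --> X]subr0; apply: cvgB; first exact: cvg_cst.
have := @cvg_harmonic R.
by rewrite -cvg_shiftS.
Qed.

End player_count.

(** * Existence, uniqueness, limit and monotonicity of the thresholds *)

Theorem proposition11 (R : realType) (d : measure_display)
    (T : measurableType d) (P : probability T R) (B : R -> {RV P >-> R})
    (hB : standard_brownian_motion B)
    (h : R -> R) (hh : admissible_cost h) (alpha : R) (halpha : 0 < alpha) :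
  (forall N : nat, (2 <= N)%N -> exists! c : R, threshold_many P B h alpha N c) /\
  (exists! c : R, threshold_one P B h alpha c) /\
  (forall (c_ : nat -> R) (c : R),
     (forall N : nat, (2 <= N)%N -> threshold_many P B h alpha N (c_ N)) ->
     threshold_one P B h alpha c ->
     (c_ @ \oo --> c) /\
     ((forall x : R, h x = x ^+ 2) ->
      forall M N : nat, (2 <= M)%N -> (M < N)%N -> c_ N < c_ M)).
Proof.
have [k [K [k0 _ kK]]] := cost_curvature_bounds hh.
have hk x : k < derive1n 2 h x by have [] := kK x.
have hK x : derive1n 2 h x <= K by have [] := kK x.
pose Q := occupation_law (P:=P) alpha halpha.
pose X := killed_path (B:=B).
have mX : measurable_fun setT X := measurable_killed_path hB.
have X2 : Q.-integrable setT (fun w => (X w ^+ 2)%:E).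
  exact: (integrable_killed_path_sqr hB alpha halpha).
have Xsym := @occupation_symmetric R d T P B hB alpha halpha.
have Xuni := @occupation_unimodal R d T P B hB alpha halpha.
pose v := value Q X h alpha.
have h0 x : 0 <= h x := cost_ge0_everywhere h hh k K k0 hk hK x.
have mh : measurable_fun setT h := is_derive_measurable _ _ (cost_is_derive h hh).
(* Both expected costs belong to one two-parameter family: parameters [(1, 1)] for [p_one] and
   [(shrink N, spread N)] for [p_many]. The rate of the latter is [2 * alpha * shrink N]. *)
have oneE : p_one P B alpha h = v 1 1.
  apply/funext => x; rewrite /p_one (discounted_meanE hB alpha halpha).
  - by rewrite /v /value; congr (_ * fine _); apply: eq_integral => w _; rewrite !mul1r.
  - by apply: measurableT_comp => //; exact: measurable_funD.
  - by move=> z; exact: h0.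
have manyE N : p_many P B alpha h N = v (shrink N) (spread N).
  apply/funext => x; rewrite /p_many (discounted_meanE hB alpha halpha).
  - rewrite /v /value; congr (_ * fine _); apply: eq_integral => w _; congr (h _)%:E.
    by rewrite mulrDr /spread mulrA.
  - apply: measurableT_comp => //; apply: measurable_funM => //.
    by apply: measurable_funD => //; exact: measurable_funM.
  - by move=> z; exact: h0.
have rateE N : 2 * (N%:R - 1) * alpha / N%:R = 2 * alpha * shrink N :> R.
  by rewrite /shrink; ring.
have rate0 n : 0 < 2 * alpha * shrink n.+2 by rewrite mulr_gt0 ?shrink_gt0 ?mulr_gt0.
have a20 : 0 < 2 * alpha by rewrite mulr_gt0.
have manyP n c : threshold_many P B h alpha n.+2 c ->
    positive_solution (2 * alpha * shrink n.+2) (v (shrink n.+2) (spread n.+2)) c.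
  by rewrite /threshold_many manyE rateE.
have exu := threshold_value_exists_unique Q X mX X2 Xsym Xuni h alpha hh halpha k K k0 hk hK.
split; [|split].
- move=> [|[|n]]// _; rewrite /threshold_many manyE rateE.
  exact: (exu _ _ _ (shrink_gt0 n) (spread_gt0 n) (rate0 n)).
- rewrite /threshold_one oneE; exact: (exu _ _ _ ltr01 ltr01 a20).
move=> c_ c c_P; rewrite /threshold_one oneE => cP.
have c_P' n := manyP n (c_ n.+2) (c_P n.+2 isT).
have rate_cvg : 2 * alpha * shrink n.+2 @[n --> \oo] --> 2 * alpha.
  rewrite -[X in _ --> X]mulr1; apply: cvgM; first exact: cvg_cst.
  exact: cvg_shrink.
split.
  (* The sequence is shifted by two, since nothing is known of [c_ 0] and [c_ 1]. *)
  rewrite -cvg_shiftS -(cvg_shiftS (fun n => c_ n.+1)).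
  exact: (threshold_value_cvg Q X mX X2 Xuni h alpha hh halpha k K k0 hk hK
    (fun n => shrink n.+2) (fun n => spread n.+2)
    (fun n => 2 * alpha * shrink n.+2) (fun n => c_ n.+2) (2 * alpha) c
    shrink_gt0 shrink_le_spread rate0 a20 cvg_shrink rate_cvg c_P' cP).
move=> hsq [|[|m]]// [|[|n]]// _; rewrite !ltnS => mn.
have quad n := quadratic_thresholdE Q X mX X2 Xsym h alpha hh halpha k K k0 hk hK
  _ _ _ _ hsq (shrink_gt0 n) (c_P' n).
have [cm0 cmE] := quad m; have [cn0 cnE] := quad n.
set rm := Num.sqrt _ in cmE; set rn := Num.sqrt _ in cnE.
have rm0 : 0 < rm by rewrite sqrtr_gt0.
have rn0 : 0 < rn by rewrite sqrtr_gt0.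
have amn : shrink m.+2 < shrink n.+2 :> R := shrink_ltr m n mn.
have rmn : rm <= rn.
  rewrite /rm /rn ler_sqrt ?(ltW (rate0 n))//.
  by apply: ler_wpM2l; [exact: (ltW a20)|exact: (ltW amn)].
have qmn : alpha / (2 * shrink n.+2 ^+ 2) < alpha / (2 * shrink m.+2 ^+ 2).
  rewrite ltr_pM2l// ltf_pV2 ?posrE ?mulr_gt0 ?exprn_gt0 ?shrink_gt0//.
  by rewrite ltr_pM2l// ltr_pXn2r// nnegrE ltW// shrink_gt0.
(* If [c_ m.+2 <= c_ n.+2], contraction and then [rm <= rn] give [c - T c] at least as large for [n]
   as for [m]. By the threshold equations these are the two sides of [qmn], which orders them the
   other way. *)
rewrite ltNge; apply/negP => cmn.
have T1 := tanh_scaled_noninc rm rn (c_ m.+2) rm0 rmn cm0.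
have T2 : tanh_scaled rn (c_ n.+2) - tanh_scaled rn (c_ m.+2) <= c_ n.+2 - c_ m.+2.
  move: cmn; rewrite le_eqVlt => /predU1P[->|cmn]; first by rewrite !subrr.
  by rewrite ltW// tanh_scaled_contract// ltW.
move: T1 T2; rewrite cmE cnE; lra.
Qed.
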